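(* Let $0<p,m,q<\infty$, $0<\alpha\le r<\infty$ and $v,w\in\mathcal W(0,\infty)$. Assume that $\phi:(0,\infty)\to(0,\infty)$ is a quasi-increasing function with $\phi\in Q_r(0,\infty)$. Suppose that $b\in\mathcal W(0,\infty)$ is such that $B(t):=\int_0^t b(s)\,ds$ satisfies $0<B(t)<\infty$ for all $t>0$, $B\in\Delta_2$, $B(\infty)=\infty$, and $B(t)/t^{\alpha/r}$ is quasi-increasing. Then there is a constant $C>0$ such that $$\Big(\int_0^\infty\big[(M_{\phi,\Lambda^\alpha(b)}f)^*(x)\big]^q w(x)\,dx\Big)^{\frac1q}\le C\Big(\int_0^\infty\Big(\int_0^x[f^*(\tau)]^p\,d\tau\Big)^{\frac mp}v(x)\,dx\Big)^{\frac1m}$$ holds for all $f\in\mathfrak M(\mathbb R^n)$ if and only if there is a constant $C>0$ such that $$\Big(\int_0^\infty\big[T_{B/\phi^\alpha,b}h^*(x)\big]^{\frac q\alpha}w(x)\,dx\Big)^{\frac1q}\le C\Big(\int_0^\infty\Big(\int_0^x[h^*(\tau)]^{\frac p\alpha}\,d\tau\Big)^{\frac mp}v(x)\,dx\Big)^{\frac1m}$$ holds for all $h\in\mathfrak M(\mathbb R^n)$.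
   Context: $\mathfrak M(\mathbb R^n)$ is the set of Lebesgue measurable functions on $\mathbb R^n$. The non-increasing rearrangement of $f$ is $f^*(t)=\inf\{\lambda\ge 0: |\{x\in\mathbb R^n:|f(x)|>\lambda\}|\le t\}$. $\mathcal W(0,\infty)$ is the set of weights, i.e. locally integrable non-negative functions on $(0,\infty)$. $B(\infty):=\lim_{t\to\infty}B(t)$. $\|f\|_{\Lambda^\alpha(b)}:=\big(\int_0^\infty[f^*(s)]^\alpha b(s)\,ds\big)^{1/\alpha}$, and the generalized maximal function is $$M_{\phi,\Lambda^\alpha(b)}f(x):=\sup_{Q\ni x}\frac{\|f\chi_Q\|_{\Lambda^\alpha(b)}}{\phi(|Q|)},\qquad x\in\mathbb R^n,$$ the supremum being over all open cubes $Q\subset\mathbb R^n$ with sides parallel to the coordinate axes containing $x$. $(T_{u,b}g)(t):=\sup_{\tau\in[t,\infty)}\frac{u(\tau)}{B(\tau)}\int_0^\tau g(s)b(s)\,ds$; in particular $(T_{B/\phi^\alpha,b}h^* )(t)=\sup_{\tau\in[t,\infty)}\phi(\tau)^{-\alpha}\int_0^\tau h^*(s)b(s)\,ds$. A function $\psi:(0,\infty)\to(0,\infty)$ satisfies $\psi\in\Delta_2$ if $\psi(2t)\le C\psi(t)$ for all $t>0$ and some $C>0$; it is quasi-increasing if $\psi(t_1)\le C\psi(t_2)$ whenever $0<t_1\le t_2<\infty$, for some $C>0$; and $\psi\in Q_r(0,\infty)$ if, for some $C>0$, $\psi\big(\sum_{i=1}^N t_i\big)\le C\big(\sum_{i=1}^N\psi(t_i)^r\big)^{1/r}$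 for every finite set of positive numbers $\{t_1,\dots,t_N\}$. *)

(* Defs.v *)
From HB Require Import structures.
From mathcomp Require Import all_boot all_order all_algebra.
From mathcomp Require Import all_classical all_reals all_analysis.
From mathcomp Require Import measurable_realfun.

Set Implicit Arguments.
Unset Strict Implicit.
Unset Printing Implicit Defensive.
Import Order.TTheory GRing.Theory Num.Theory.
Import numFieldNormedType.Exports.

Local Open Scope classical_set_scope.
Local Open Scope ring_scope.
Local Open Scope ereal_scope.

Section lebesgue_cons.
Context {R : realType} (n : nat).
Local Notation RB := (measurableTypeR R).
Variable m : {sigma_finite_measure set (n.-tuple RB) -> \bar R}.

Definition tuple_cons (p : RB * n.-tuple RB) : n.+1.-tuple RB :=
  [tuple of p.1 :: p.2].

Lemma measurable_tuple_cons : measurable_fun [set: RB * n.-tuple RB] tuple_cons.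
Proof. exact: measurable_cons. Qed.

(* the product of the Lebesgue measure of the line with m, carried from
   R * R^n to R^(n+1) *)
Definition lebesgue_cons : set (n.+1.-tuple RB) -> \bar R :=
  pushforward (lebesgue_measure \x m) tuple_cons.

Let lebesgue_cons0 : lebesgue_cons set0 = 0.
Proof. by rewrite /lebesgue_cons /pushforward preimage_set0 measure0. Qed.

Let lebesgue_cons_ge0 A : 0 <= lebesgue_cons A.
Proof. by rewrite /lebesgue_cons /pushforward measure_ge0. Qed.

Let preimage_cons_measurable (A : set (n.+1.-tuple RB)) :
  measurable A -> measurable (tuple_cons @^-1` A).
Proof.
by move=> mA; rewrite -[X in measurable X]setTI; exact: measurable_tuple_cons.
Qed.

Let lebesgue_cons_sigma_additive : semi_sigma_additive lebesgue_cons.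
Proof.
move=> F mF tF mUF; rewrite /lebesgue_cons /pushforward preimage_bigcup.
apply: measure_semi_sigma_additive.
- by move=> k; exact: preimage_cons_measurable.
- apply/trivIsetP => /= i j _ _ ij; rewrite -preimage_setI.
  by move/trivIsetP : tF => /(_ _ _ _ _ ij) ->//; rewrite preimage_set0.
- by rewrite -preimage_bigcup; exact: preimage_cons_measurable.
Qed.

HB.instance Definition _ := isMeasure.Build _ _ _ lebesgue_cons
  lebesgue_cons0 lebesgue_cons_ge0 lebesgue_cons_sigma_additive.

Let lebesgue_cons_sigma_finite : sigma_finite setT lebesgue_cons.
Proof.
have /sigma_finiteP[F [TF ndF Foo]] :=
  sigma_finiteT (@lebesgue_measure R : {sigma_finite_measure set RB -> \bar R}).
have /sigma_finiteP[G [TG ndG Goo]] := sigma_finiteT m.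
exists (fun k => (@tnth _ RB ^~ ord0) @^-1` F k `&`
                 (fun t : n.+1.-tuple RB => [tuple of behead t]) @^-1` G k).
  apply/esym; rewrite -subTset => t _.
  have [k _ Fk] : (\bigcup_k F k) (tnth t ord0) by rewrite -TF.
  have [l _ Gl] : (\bigcup_l G l) [tuple of behead t] by rewrite -TG.
  exists (maxn k l) => //; split.
    by apply: (subsetPset _ _ (ndF _ _ (leq_maxl k l))).
  by apply: (subsetPset _ _ (ndG _ _ (leq_maxr k l))).
move=> k; have [mF Fk] := Foo k; have [mG Gk] := Goo k; split.
  apply: measurableI; rewrite -[X in measurable X]setTI.
    exact: measurable_tnth.
  exact: measurable_behead.
rewrite /lebesgue_cons /pushforward (_ : _ @^-1` _ = F k `*` G k).
  by rewrite product_measure1E// lte_mul_pinfty// ge0_fin_numE.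
rewrite predeqE => -[x t].
have e : [tuple of behead (tuple_cons (x, t))] = t by exact/val_inj.
by rewrite /preimage /setI /mkset e.
Qed.

HB.instance Definition _ := Measure_isSigmaFinite.Build _ _ _ lebesgue_cons
  lebesgue_cons_sigma_finite.

End lebesgue_cons.

(* n-fold product of the Lebesgue measure, on the product sigma-algebra *)
Fixpoint tuple_lebesgue {R : realType} (n : nat) :
    {sigma_finite_measure set (n.-tuple (measurableTypeR R)) -> \bar R} :=
  match n with
  | 0 => \d_([tuple] : 0.-tuple (measurableTypeR R))
  | k.+1 => lebesgue_cons (tuple_lebesgue k)
  end.


(* R^n with its Lebesgue measurable sets, which are the Caratheodory measurable
   sets of the outer measure generated by tuple_lebesgue *)
Notation euclid R n :=
  (@caratheodory_type R (n.-tuple (measurableTypeR R))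
    (mu_ext (@tuple_lebesgue R n))).

Definition lebesgue_euclid {R : realType} {n : nat} :
    set (euclid R n) -> \bar R :=
  @completed_measure_extension _ (n.-tuple (measurableTypeR R)) R
    (tuple_lebesgue n).
HB.instance Definition _ R n := Measure.on (@lebesgue_euclid R n).

(* the sigma-algebra on which completed_lebesgue_measure is defined *)
Notation eline R :=
  (@caratheodory_type R (ocitv_type R) (mu_ext (@wlength R idfun))).

Section function_classes.
Context {R : realType}.
Implicit Types (b psi : R -> R) (r : R).
Local Notation mu := (@completed_lebesgue_measure R).

(* locally integrable, i.e. integrable on the compact subsets of ]0, +oo[, and
   non-negative *)
Definition weight b : Prop :=
  [/\ measurable_fun (`]0%R, +oo[ : set (eline R)) b,
      forall t, (0 < t)%R -> (0 <= b t)%R &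
      forall K : set R, compact K -> K `<=` `]0%R, +oo[ ->
        \int[mu]_(s in K) (b s)%:E < +oo].

Definition primitive b (t : R) : \bar R := \int[mu]_(s in `]0%R, t[) (b s)%:E.

Definition delta2 psi : Prop :=
  exists2 C : R, (0 < C)%R &
    forall t, (0 < t)%R -> (psi (2 * t) <= C * psi t)%R.

Definition quasi_increasing psi : Prop :=
  exists2 C : R, (0 < C)%R &
    forall t1 t2, (0 < t1)%R -> (t1 <= t2)%R -> (psi t1 <= C * psi t2)%R.

(* N.+1 terms, since psi is meaningful only on ]0, +oo[ *)
Definition Qclass r psi : Prop :=
  exists2 C : R, (0 < C)%R &
    forall (N : nat) (t : 'I_N.+1 -> R), (forall i, 0 < t i)%R ->
      (psi (\sum_i t i) <= C * (\sum_i (psi (t i) `^ r)) `^ r^-1)%R.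

End function_classes.

Section operators.
Context {R : realType}.
Implicit Types (alpha t : R) (b phi u : R -> R) (g : R -> \bar R).
Local Notation mu := (@completed_lebesgue_measure R).

(* the functions on R^n take their values in the extended reals: maximal_fun
   can be infinite *)
Definition lebesgue_measurable {n : nat} (f : n.-tuple R -> \bar R) : Prop :=
  measurable_fun [set: euclid R n] f.

Definition rearrangement {n : nat} (f : n.-tuple R -> \bar R) t : \bar R :=
  ereal_inf [set l%:E | l in [set l : R | (0 <= l)%R /\
    lebesgue_euclid [set x : n.-tuple R | l%:E < `|f x|] <= t%:E]].

Definition lorentz_norm {n : nat} alpha b (f : n.-tuple R -> \bar R) : \bar R :=
  (\int[mu]_(s in `]0%R, +oo[)
     (rearrangement f s `^ alpha * (b s)%:E)) `^ alpha^-1.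

Definition open_cube {n : nat} (a : n.-tuple R) (l : R) : set (n.-tuple R) :=
  [set x | forall i, (tnth a i < tnth x i < tnth a i + l)%R].

Definition maximal_fun {n : nat} phi alpha b (f : n.-tuple R -> \bar R)
    (x : n.-tuple R) : \bar R :=
  ereal_sup [set lorentz_norm alpha b (fun y => f y * (\1_Q y)%:E) *
                 ((phi (fine (lebesgue_euclid Q)))^-1)%:E
            | Q in [set Q | (exists a l, (0 < l)%R /\ Q = open_cube a l) /\
                            Q x]].

Definition sup_operator u b g t : \bar R :=
  ereal_sup [set (u tau / fine (primitive b tau))%:E *
                 \int[mu]_(s in `]0%R, tau[) (g s * (b s)%:E)
            | tau in `[t, +oo[].

Lemma lebesgue_open_cube (n : nat) (a : n.-tuple R) (l : R) : (0 < l)%R ->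
  lebesgue_euclid (open_cube a l) = (l ^+ n)%:E.
Proof.
move=> l0.
suff [mQ <-] : measurable (open_cube a l : set (n.-tuple (measurableTypeR R))) /\
    tuple_lebesgue n (open_cube a l) = (l ^+ n)%:E.
  exact: measurable_mu_extE.
elim: n a => [|n IH] a.
  have -> : open_cube a l = setT by rewrite -subTset => x _ [].
  by split; [exact: measurableT|rewrite /= diracT].
pose a' : n.-tuple R := [tuple of behead a].
have [mQ IHa] := IH a'.
have inc (c : R) : measurable (`]c, (c + l)%R[%classic : set (measurableTypeR R)).
  exact: measurable_itv.
have lenQ (c : R) : lebesgue_measure `]c, (c + l)%R[ = l%:E :> \bar R.
  by rewrite lebesgue_measure_itv/= lte_fin ltrDl l0 -EFinB addrAC subrr add0r.
have E : open_cube a l =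
    (fun x : n.+1.-tuple (measurableTypeR R) => tnth x ord0) @^-1`
      `]tnth a ord0, (tnth a ord0 + l)%R[ `&`
    (fun x : n.+1.-tuple (measurableTypeR R) => [tuple of behead x]) @^-1`
      open_cube a' l.
  rewrite predeqE => x; split=> [Hx|[Hx Hx'] i].
    split; first by rewrite /= in_itv/=; exact: Hx.
    by move=> i; rewrite !tnth_behead; exact: Hx.
  have [->|i0] := eqVneq i ord0; first by move: Hx; rewrite /= in_itv.
  have [j ->] : exists j : 'I_n, i = lift ord0 j.
    by case: (unliftP ord0 i) i0 => [j -> _|->]; [exists j|rewrite eqxx].
  have := Hx' j; rewrite !tnth_behead.
  by rewrite (_ : inord j.+1 = lift ord0 j)//; apply/val_inj; rewrite /= inordK// ltnS ltn_ord.
split.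
  rewrite E; apply: measurableI; rewrite -[X in measurable X]setTI.
    by apply: measurable_tnth.
  by apply: measurable_behead.
rewrite /= /lebesgue_cons /pushforward E.
rewrite (_ : _ @^-1` _ = `]tnth a ord0, (tnth a ord0 + l)%R[ `*` open_cube a' l).
  rewrite product_measure1E//.
  by rewrite [X in X * _]lenQ IHa -EFinM exprS.
rewrite predeqE => -[x t].
have e : [tuple of behead (tuple_cons (x, t))] = t by exact/val_inj.
by rewrite /preimage /setI /mkset e.
Qed.

End operators.

(* Main.v *)
Require Import Defs.
From mathcomp Require Import all_boot all_order all_algebra.
From mathcomp Require Import all_classical all_reals all_analysis.
From mathcomp Require Import measurable_realfun.
From mathcomp Require Import ring lra.

Import Order.TTheory GRing.Theory Num.Theory.
Import numFieldNormedType.Exports.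

Local Open Scope classical_set_scope.
Local Open Scope ring_scope.
Local Open Scope ereal_scope.

(** Write [G(tau) = phi(tau)^(-alpha) * int_0^tau h^* b], so that the operator in
    the second inequality, applied to [h^*], is the supremum of [G] over
    [tau >= t]. The theorem follows from two pointwise bounds, since both
    inequalities have the same right-hand side when [h] and [|f|^alpha] are
    equimeasurable.

    Upper bound ([rearrangement_maximal_le]): for every [f], with
    [h = |f|^alpha], the rearrangement of [M f] at [t] is at most a constant times
    [sup_(tau >= t) G(tau)^(1/alpha)]. If [M f > l] on a set of measure more than
    [t], the covering argument [vitali_covering] yields disjoint cubes [Q_i] on
    which [l phi(|Q_i|)] is below the Lorentz norm of [f chi_{Q_i}] and whose
    total measure [T] satisfies [3^n T > t]. Summing the [r]-th powers, the left
    sides add up to at least [l^r phi(T)^r], up to a constant, by the [Q_r]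
    condition, and the right sides to at most a multiple of [A^(r/alpha)], where
    [A = int_0^T h^* b], because the Lorentz functional has a lower
    [r]-estimate ([lorentz_lower_estimate]). Hence [l <= C G(T)^(1/alpha)], and
    the [Q_r] condition with equal entries lets [T] be replaced by [3^n T].

    The lower [r]-estimate is where the growth of [B] enters. By the layer-cake
    formula ([lorentz_layer_cake]), [int H^* b] is the integral over [l > 0] of
    [B] at the measure of [{|H| > l}]. The measures [d_i] of the pieces of such a
    superlevel set in disjoint sets add up to the measure [D] of the whole, and
    quasi-monotonicity of [B(t) / t^(alpha/r)] gives
    [B(d_i) <= K (d_i / D)^(alpha/r) B(D)].

    Lower bound ([rearrangement_maximal_ge]): given [h], let [f] be the power
    [1/alpha] of [h^*] transplanted to the space along centred cubes, so that [f]
    has the power [1/alpha] of [h^*] as its rearrangement. Every point of the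
    centred cube of volume [tau] sees that cube in the supremum defining [M f],
    so [M f >= G(tau)^(1/alpha)] on a set of measure [tau]. Therefore the
    rearrangement of [M f] at [t] is at least [G(tau)^(1/alpha)] for all
    [tau > t], and the endpoint [tau = t] is reached by doubling. *)

(** * Rearrangements as generalized inverses *)


Lemma le_of_real_lt {R : realType} (x y : \bar R) : 0 <= y ->
  (forall l : R, (0 <= l)%R -> l%:E < x -> l%:E <= y) -> x <= y.
Proof.
move=> y0 xy; rewrite leNgt; apply/negP => yx.
have : y \is a fin_num by rewrite ge0_fin_numE// (lt_le_trans yx) ?leey.
move: y y0 xy yx => [y| |]//; rewrite lee_fin => y0 xy yx _.
case: x yx xy => [x| |]//; last first.
  move=> _ /(_ (y + 1)%R); rewrite lee_fin ltry addr_ge0// => /(_ isT isT); lra.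
rewrite lte_fin => yx /(_ ((x + y) / 2)%R); rewrite lee_fin lte_fin => H.
suff : ((x + y) / 2 <= y)%R by lra.
by apply: H; lra.
Qed.

Lemma eq_of_real_lt {R : realType} (x y : \bar R) : 0 <= x -> 0 <= y ->
  (forall l : R, (0 <= l)%R -> (l%:E < x) = (l%:E < y)) -> x = y.
Proof.
move=> x0 y0 xy; apply/eqP; rewrite eq_le; apply/andP; split.
- by apply: le_of_real_lt => // l l0; rewrite xy// => /ltW.
- by apply: le_of_real_lt => // l l0; rewrite -xy// => /ltW.
Qed.

Lemma lt_poweR_root {R : realType} (a l : R) (x : \bar R) :
  (0 < a)%R -> (0 <= l)%R -> 0 <= x ->
  (l%:E < x `^ a) = ((l `^ a^-1)%:E < x).
Proof.
move=> a0 l0; case: x => [x| |]//.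
  rewrite lee_fin => x0; rewrite poweR_EFin !lte_fin.
  have {1}-> : (l = (l `^ a^-1) `^ a)%R.
    by rewrite -powRrM mulVf ?gt_eqF// powRr1.
  have mono := @gt0_ltr_powR _ _ a0.
  apply/idP/idP => [|?]; last by apply: mono; rewrite ?nnegrE ?powR_ge0.
  apply: contraTT; rewrite -!leNgt => ?.
  by apply: ge0_ler_powR; rewrite ?nnegrE ?powR_ge0// ltW.
by rewrite poweRyr ?gt_eqF// !ltry.
Qed.

Lemma le_poweR {R : realType} (a : R) (x y : \bar R) :
  (0 <= a)%R -> 0 <= x -> x <= y -> x `^ a <= y `^ a.
Proof.
move=> a0 x0 xy; apply: gt0_ler_poweR => //; rewrite in_itv/= leey andbT//.
exact: le_trans xy.
Qed.

Lemma rearrangement_ge0 {R : realType} {n : nat} (f : n.-tuple R -> \bar R) t :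
  0 <= rearrangement f t.
Proof. by apply: le_ereal_inf_tmp => _ [l [l0 _] <-]; rewrite lee_fin. Qed.

Lemma measurable_superlevel {R : realType} {n : nat} (f : n.-tuple R -> \bar R)
    (l : R) : lebesgue_measurable f ->
  measurable ([set x | l%:E < `|f x|] : set (euclid R n)).
Proof.
move=> mf; rewrite -[X in measurable X]setTI.
apply: emeasurable_fun_o_infty; first exact: measurableT.
exact: measurableT_comp.
Qed.

(** The superlevel sets at heights decreasing to [l] exhaust the one at height
    [l], so the measure is continuous from below along them. *)
Lemma distribution_right_continuous {R : realType} {n : nat}
    (f : n.-tuple R -> \bar R) (l : R) (t : \bar R) : lebesgue_measurable f ->
  t < lebesgue_euclid [set x | l%:E < `|f x|] ->
  exists2 l' : R, (l < l')%R & t < lebesgue_euclid [set x | l'%:E < `|f x|].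
Proof.
move=> mf tl.
pose F k : set (euclid R n) := [set x | (l + k.+1%:R^-1)%:E < `|f x|].
have FE : \bigcup_k F k = [set x | l%:E < `|f x|].
  rewrite eqEsubset; split => x.
    move=> [k _]; apply: lt_trans.
    by rewrite lte_fin ltrDl invr_gt0.
  move=> /= lx.
  have [y ly yx] : exists2 y : R, (l < y)%R & y%:E <= `|f x|.
    case: `|f x| lx => [y| |]//; first by rewrite lte_fin; exists y.
    by move=> _; exists (l + 1)%R; rewrite ?ltrDl ?leey.
  have [k] := ltr_add_invr ly.
  by move=> lky; exists k => //=; apply: lt_le_trans yx; rewrite lte_fin.
have mF k : measurable (F k) by exact: measurable_superlevel.
have ndF : nondecreasing_seq F.
  move=> i j ij; apply/subsetPset => x; apply: le_lt_trans.
  by rewrite lee_fin lerD2l lef_pV2 ?posrE// ler_nat.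
have /= cvgF := nondecreasing_cvg_mu (mu := @lebesgue_euclid R n) mF
  (bigcup_measurable (fun k _ => mF k)) ndF.
apply: contrapT => no.
move: tl; rewrite ltNge => /negP; apply; rewrite -FE -(cvg_lim _ cvgF)//.
apply: lime_le; first by apply/cvg_ex; eexists; exact: cvgF.
apply: nearW => k /=; rewrite leNgt; apply/negP => tk; apply: no.
by exists (l + k.+1%:R^-1)%R => //; rewrite ltrDl invr_gt0.
Qed.

Lemma lt_superlevel_of_lt_rearrangement {R : realType} {n : nat}
    (f : n.-tuple R -> \bar R) (l t : R) : (0 <= l)%R ->
  l%:E < rearrangement f t ->
  t%:E < lebesgue_euclid [set x | l%:E < `|f x|].
Proof.
move=> l0; apply: contraTT; rewrite -!leNgt => lt.
by apply: ereal_inf_lbound; exists l.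
Qed.

(** The rearrangement is the generalized inverse of the distribution function;
    all facts about rearrangements below are read off from this equivalence. *)
Lemma lt_rearrangement {R : realType} {n : nat} (f : n.-tuple R -> \bar R)
    (l t : R) : lebesgue_measurable f -> (0 <= l)%R ->
  (l%:E < rearrangement f t) =
  (t%:E < lebesgue_euclid [set x | l%:E < `|f x|]).
Proof.
move=> mf l0; apply/idP/idP => [|tl].
  exact: lt_superlevel_of_lt_rearrangement.
have [l' ll' tl'] := distribution_right_continuous _ _ _ mf tl.
apply: (@lt_le_trans _ _ l'%:E); first by rewrite lte_fin.
apply: le_ereal_inf_tmp => _ [k [k0 kt] <-]; rewrite lee_fin leNgt; apply/negP => kl.
move: tl'; rewrite ltNge => /negP; apply; apply: le_trans kt.
apply: le_measure; rewrite ?inE; try exact: measurable_superlevel.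
by move=> x; apply: lt_trans; rewrite lte_fin.
Qed.

Lemma le_rearrangement {R : realType} {n : nat} (f g : n.-tuple R -> \bar R) :
  lebesgue_measurable f -> lebesgue_measurable g ->
  (forall x, `|f x| <= `|g x|) ->
  forall t, rearrangement f t <= rearrangement g t.
Proof.
move=> mf mg fg t; apply: le_of_real_lt; first exact: rearrangement_ge0.
move=> l l0; rewrite lt_rearrangement// => tl; apply/ltW.
rewrite lt_rearrangement//; apply: (lt_le_trans tl).
apply: le_measure; rewrite ?inE; try exact: measurable_superlevel.
by move=> x /= /lt_le_trans; apply.
Qed.

Lemma measurable_abse_powR {R : realType} {n : nat} (f : n.-tuple R -> \bar R)
    (a : R) : lebesgue_measurable f ->
  lebesgue_measurable (fun x => `|f x| `^ a).
Proof.
move=> mf; apply: (measurableT_comp (measurable_poweR a)).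
exact: measurableT_comp.
Qed.

Lemma rearrangement_poweR {R : realType} {n : nat} (f : n.-tuple R -> \bar R)
    (a : R) : lebesgue_measurable f -> (0 < a)%R ->
  forall t, rearrangement (fun x => `|f x| `^ a) t = rearrangement f t `^ a.
Proof.
move=> mf a0 t; apply: eq_of_real_lt; rewrite ?rearrangement_ge0 ?poweR_ge0//.
move=> l l0; rewrite lt_poweR_root ?rearrangement_ge0//.
rewrite !lt_rearrangement ?powR_ge0//; last exact: measurable_abse_powR.
congr (_ < lebesgue_euclid _); apply/seteqP.
by split => x /=; rewrite (gee0_abs (poweR_ge0 _ _)) lt_poweR_root.
Qed.

Lemma rearrangement_nincr {R : realType} {n : nat} (f : n.-tuple R -> \bar R)
    (s t : R) : (s <= t)%R -> rearrangement f t <= rearrangement f s.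
Proof.
move=> st; apply: ereal_inf_le_tmp => _ [l [l0 ls] <-]; exists l => //; split => //.
by apply: (le_trans ls); rewrite lee_fin.
Qed.

(** * The layer-cake formula for rearrangements *)


Lemma measurable_eline {R : realType} (A : set R) :
  measurable (A : set (measurableTypeR R)) -> measurable (A : set (eline R)).
Proof. exact: sub_caratheodory. Qed.

Lemma measurable_itv_eline {R : realType} (i : interval R) :
  measurable ([set` i] : set (eline R)).
Proof. by apply: measurable_eline; exact: measurable_itv. Qed.

Lemma measurable_fun_nincr {R : realType} (g : R -> \bar R) :
  (forall s t, (0 < s)%R -> (s <= t)%R -> g t <= g s) ->
  measurable_fun (`]0%R, +oo[ : set (eline R)) g.
Proof.
move=> ng; apply: (measurability _ (ErealGenOInfty.measurableE R)).
move=> _ [_ [x ->] <-]; apply: measurable_eline.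
apply: is_interval_measurable => s t /= [s0 gs] [t0 gt] z /andP[sz zt].
move: s0 t0 gs gt; rewrite /= !in_itv/= !andbT => s0 t0 gs gt.
have z0 : (0 < z)%R by exact: lt_le_trans sz.
by split => //; apply: (lt_le_trans gt); exact: ng.
Qed.

Lemma lebesgue_measure_below {R : realType} (y : \bar R) : 0 <= y ->
  lebesgue_measure [set l : R | (0 < l)%R && (l%:E < y)] = y.
Proof.
case: y => [y| |]// y0.
- rewrite (_ : [set _ | _] = `]0%R, y[%classic); last first.
    by apply/seteqP; split => l /=; rewrite in_itv/= lte_fin.
  rewrite lebesgue_measure_itv/= lte_fin -EFinB subr0.
  by move: y0; rewrite lee_fin; case: ltgtP => // <-.
- rewrite (_ : [set _ | _] = `]0%R, +oo[%classic); last first.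
    by apply/seteqP; split => l /=; rewrite in_itv/= ltry.
  by rewrite lebesgue_measure_itv/= ltry.
Qed.

Section layer_cake.
Context {R : realType}.
Variables (b : R -> R) (g : R -> \bar R).
Local Notation mu := (@completed_lebesgue_measure R).
Hypothesis mb : measurable_fun (`]0%R, +oo[ : set (eline R)) b.
Hypothesis b0 : forall t, (0 < t)%R -> (0 <= b t)%R.
Hypothesis mg : measurable_fun (`]0%R, +oo[ : set (eline R)) g.
Hypothesis g0 : forall t, (0 < t)%R -> 0 <= g t.

Let D : set (eline R) := `]0%R, +oo[.
Let subgraph : set (eline R * measurableTypeR R) :=
  [set z | (0 < z.2)%R && (z.2%:E < (g \_ D) z.1)].
Let F (z : eline R * measurableTypeR R) : \bar R :=
  ((b \_ D) z.1)%:E * (\1_subgraph z)%:E.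

Let mD : measurable D. Proof. exact: measurable_itv_eline. Qed.

Let bD0 x : (0 <= (b \_ D) x)%R.
Proof.
rewrite patchE; case: ifPn => // /set_mem; rewrite /D/= in_itv/= andbT.
exact: b0.
Qed.

Let gD0 x : 0 <= (g \_ D) x.
Proof.
rewrite patchE; case: ifPn => // /set_mem; rewrite /D/= in_itv/= andbT.
exact: g0.
Qed.

Let msubgraph : measurable subgraph.
Proof.
have -> : subgraph = ([set: eline R] `*` `]0%R, +oo[) `&`
    (setT `&` [set z | z.2%:E < (g \_ D) z.1]).
  by apply/seteqP; split => z; rewrite /subgraph/= in_itv/= ?andbT;
    [case/andP|case=> -[_ ->] [_ ->]].
apply: measurableI.
  by apply: measurableX => //; exact: measurable_itv.
apply: measurable_lte; first exact: measurableT.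
  by apply/measurable_EFinP; exact: measurable_snd.
apply: measurableT_comp; last exact: measurable_fst.
by apply/(measurable_restrictT _ _).1.
Qed.

Let mF : measurable_fun setT F.
Proof.
apply: emeasurable_funM.
  apply/measurable_EFinP; apply: measurableT_comp; last exact: measurable_fst.
  by apply/(measurable_restrictT _ _).1.
by apply/measurable_EFinP; exact: measurable_indic.
Qed.

Let F0 z : 0 <= F z.
Proof. by rewrite mule_ge0// lee_fin. Qed.

Let int_F2 s : \int[@lebesgue_measure R]_l F (s, l) =
  ((fun s => g s * (b s)%:E) \_ D) s.
Proof.
rewrite /F/= ge0_integralZl//; last 2 first.
- apply/measurable_EFinP.
  rewrite (_ : (fun l => _) = \1_[set l | subgraph (s, l)]); last first.
    by apply/funext => l; rewrite !indicE; congr (_%:R)%R; apply/idP/idP; rewrite !inE.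
  apply: measurable_indic.
  rewrite (_ : [set l | _] = xsection subgraph s); first exact: measurable_xsection.
  by apply/seteqP; split => l; rewrite /xsection/= inE.
- by rewrite lee_fin.
have -> : \int[@lebesgue_measure R]_l (\1_subgraph (s, l))%:E = (g \_ D) s.
  rewrite -[RHS]lebesgue_measure_below//.
  rewrite -[X in _ = lebesgue_measure X]setIT -integral_indic//.
  rewrite (_ : [set l | _] = xsection subgraph s); first exact: measurable_xsection.
  by apply/seteqP; split => l; rewrite /xsection/= inE.
by rewrite !patchE; case: ifPn; rewrite ?mul0e// muleC.
Qed.

Let int_F1 l : \int[mu]_s F (s, l) =
  ((fun l => \int[mu]_(s in D `&` [set s | l%:E < g s]) (b s)%:E)
     \_ `]0%R, +oo[) l.
Proof.
rewrite patchE; case: ifPn => [/set_mem|/negP l0].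
  rewrite /= in_itv/= andbT => l0.
  rewrite [RHS]integral_mkcond; apply: eq_integral => s _.
  rewrite /F !patchE indicE/= in_setI; case: ifPn => sD /=; last by rewrite mul0e.
  have -> : ((s, l) \in subgraph) = (s \in [set s | l%:E < g s]).
    by apply/idP/idP; rewrite !inE /subgraph/= patchE sD l0.
  by case: ifPn; rewrite ?mule1 ?mule0.
rewrite integral0_eq// => s _; rewrite /F indicE.
rewrite (_ : (s, l) \in subgraph = false) ?mule0//.
apply/negbTE/negP; rewrite inE => -[/andP[l1 _]]; apply: l0.
by rewrite inE/= in_itv/= andbT.
Qed.

(** Cavalieri's principle for the weighted measure [b(s)ds]: both sides are
    iterated integrals of [b] over the region under the graph of [g]. *)
Lemma layer_cake : \int[mu]_(s in `]0%R, +oo[) (g s * (b s)%:E) =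
  \int[@lebesgue_measure R]_(l in `]0%R, +oo[)
    \int[mu]_(s in `]0%R, +oo[ `&` [set s | l%:E < g s]) (b s)%:E.
Proof.
rewrite integral_mkcond [RHS]integral_mkcond.
transitivity (\int[mu]_s \int[@lebesgue_measure R]_l F (s, l)).
  by apply: eq_integral => s _; rewrite int_F2.
transitivity (\int[@lebesgue_measure R]_l \int[mu]_s F (s, l)).
  exact: fubini_tonelli.
by apply: eq_integral => l _; exact: int_F1.
Qed.

Lemma measurable_layer : measurable_fun (`]0%R, +oo[ : set (measurableTypeR R))
  (fun l => \int[mu]_(s in `]0%R, +oo[ `&` [set s | l%:E < g s]) (b s)%:E).
Proof.
apply/(measurable_restrictT _ _).2; first exact: measurable_itv.
rewrite (_ : _ \_ _ = fun l => \int[mu]_s F (s, l)).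
  exact: measurable_fun_fubini_tonelli_G.
by apply/funext => l; rewrite int_F1.
Qed.

End layer_cake.

Lemma primitive_ge0 {R : realType} (b : R -> R) t : weight b ->
  0 <= primitive b t.
Proof.
move=> [_ b0 _]; apply: integral_ge0 => s; rewrite /= in_itv/= => /andP[s0 _].
by rewrite lee_fin b0.
Qed.

Lemma primitive0 {R : realType} (b : R -> R) : primitive b 0 = 0.
Proof. by rewrite /primitive set_itvoo0 integral_set0. Qed.

Lemma measurable_rearrangement_weight {R : realType} {n : nat} (b : R -> R)
    (f : n.-tuple R -> \bar R) : weight b ->
  measurable_fun (`]0%R, +oo[ : set (eline R))
    (fun s => rearrangement f s * (b s)%:E).
Proof.
move=> [mb _ _]; apply: emeasurable_funM; last exact/measurable_EFinP.
by apply: measurable_fun_nincr => s t _; exact: rearrangement_nincr.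
Qed.

Lemma rearrangement_weight_ge0 {R : realType} {n : nat} (b : R -> R)
    (f : n.-tuple R -> \bar R) s : weight b -> (0 < s)%R ->
  0 <= rearrangement f s * (b s)%:E.
Proof.
by move=> [_ b0 _] s0; rewrite mule_ge0 ?rearrangement_ge0// lee_fin b0.
Qed.

Lemma integral_rearrangement_ge0 {R : realType} {n : nat} (b : R -> R)
    (f : n.-tuple R -> \bar R) (T : R) : weight b ->
  0 <= \int[@completed_lebesgue_measure R]_(s in `]0%R, T[)
    (rearrangement f s * (b s)%:E).
Proof.
move=> wb; apply: integral_ge0 => s; rewrite /= in_itv/= => /andP[s0 _].
exact: rearrangement_weight_ge0.
Qed.

Lemma le_integral_rearrangement {R : realType} {n : nat} (b : R -> R)
    (f : n.-tuple R -> \bar R) (S T : R) : weight b -> (S <= T)%R ->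
  \int[@completed_lebesgue_measure R]_(s in `]0%R, S[)
    (rearrangement f s * (b s)%:E) <=
  \int[@completed_lebesgue_measure R]_(s in `]0%R, T[)
    (rearrangement f s * (b s)%:E).
Proof.
move=> wb ST; apply: ge0_subset_integral.
- exact: measurable_itv_eline.
- exact: measurable_itv_eline.
- apply: (@measurable_funS _ _ (eline R) _ `]0%R, +oo[).
  + exact: measurable_itv_eline.
  + by move=> s; rewrite /= !in_itv/= => /andP[->].
  + exact: measurable_rearrangement_weight.
- move=> s; rewrite /= in_itv/= => /andP[s0 _].
  exact: rearrangement_weight_ge0.
- move=> s; rewrite /= !in_itv/= => /andP[-> sS].
  exact: lt_le_trans ST.
Qed.

Section layer_cake_rearrangement.
Context {R : realType} {n : nat}.
Variables (b : R -> R) (h : n.-tuple R -> \bar R).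
Local Notation mu := (@completed_lebesgue_measure R).
Hypotheses (wb : weight b) (mh : lebesgue_measurable h).
Hypothesis h_fin : forall l : R, (0 < l)%R ->
  lebesgue_euclid [set x | l%:E < `|h x|] \is a fin_num.

Let layerE l : (0 < l)%R ->
  primitive b (fine (lebesgue_euclid [set x | l%:E < `|h x|])) =
  \int[mu]_(s in `]0%R, +oo[ `&` [set s | l%:E < rearrangement h s]) (b s)%:E.
Proof.
move=> l0; rewrite /primitive; congr (integral _ _ _).
apply/seteqP; split => s /=; rewrite !in_itv/= lt_rearrangement ?(ltW l0)//.
  move=> /andP[-> ?]; split => //.
  by rewrite -[X in _ < X]fineK ?lte_fin ?h_fin.
move=> -[/andP[-> _]] /=.
by rewrite -[X in _ < X]fineK ?lte_fin ?h_fin.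
Qed.

(** Since [l < h^*(s)] amounts to [s] lying below the distribution function at
    [l], the layer of [h^*] at height [l] carries the mass [B(mu{|h| > l})]. *)
Lemma lorentz_layer_cake :
  \int[mu]_(s in `]0%R, +oo[) (rearrangement h s * (b s)%:E) =
  \int[@lebesgue_measure R]_(l in `]0%R, +oo[)
     primitive b (fine (lebesgue_euclid [set x | l%:E < `|h x|])).
Proof.
have [mb b0 _] := wb.
have mg : measurable_fun (`]0%R, +oo[ : set (eline R)) (rearrangement h).
  by apply: measurable_fun_nincr => s t _; exact: rearrangement_nincr.
have g0 t : (0 < t)%R -> 0 <= rearrangement h t.
  by move=> _; exact: rearrangement_ge0.
rewrite (layer_cake _ _ mb b0 mg g0).
apply: eq_integral => l; rewrite inE/= in_itv/= andbT => l0.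
by rewrite layerE.
Qed.

Lemma measurable_lorentz_layer :
  measurable_fun (`]0%R, +oo[ : set (measurableTypeR R))
    (fun l => primitive b (fine (lebesgue_euclid [set x | l%:E < `|h x|]))).
Proof.
have [mb b0 _] := wb; apply: (@eq_measurable_fun _ _ (measurableTypeR R) _ _ (fun l =>
    \int[mu]_(s in `]0%R, +oo[ `&` [set s | l%:E < rearrangement h s]) (b s)%:E)).
  by move=> l; rewrite inE/= in_itv/= andbT => l0; rewrite layerE.
apply: measurable_layer => //.
- by apply: measurable_fun_nincr => s t _; exact: rearrangement_nincr.
Qed.

End layer_cake_rearrangement.

(** * Quasi-concave sums and restricted functions *)


(** A crude form of the weighted arithmetic-geometric mean inequality: both
    factors are bounded by powers of [x + y]. *)
Lemma powR_interpolation {R : realType} (x y th : R) :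
  (0 <= x -> 0 <= y -> 0 <= th -> th <= 1 ->
  y `^ (1 - th) * x `^ th <= x + y)%R.
Proof.
move=> x0 y0 th0 th1.
have [xy0|xy0] := eqVneq (x + y)%R 0%R.
  have -> : x = 0%R by lra.
  have -> : y = 0%R by lra.
  have [->|thN0] := eqVneq th 0%R; last by rewrite (powR0 thN0) mulr0 addr0.
  by rewrite powRr0 mulr1 subr0 powR0 ?oner_neq0// addr0.
rewrite -[leRHS]powRr1 ?addr_ge0// -[X in (_ <= _ `^ X)%R](subrK th 1%R).
rewrite [leRHS]powRD; last by rewrite xy0 implybT.
by apply: ler_pM; rewrite ?powR_ge0//; apply: ge0_ler_powR;
  rewrite ?nnegrE; lra.
Qed.

(** If [P(t) / t^th] is quasi-increasing then [P(d_i)] is at most a multiple of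
    [(d_i / D)^th P(D)] with [D] the sum of the [d_i], so that after pairing with
    [z_i^(1 - th)] the sum is bounded by interpolating between the two
    probability vectors [d_i / D] and [z_i / W]. *)
Lemma weighted_sum_quasi_concave {R : realType} {N : nat} (P : R -> R)
    (th K : R) (d z : 'I_N -> R) :
  (0 <= th)%R -> (th <= 1)%R -> (0 < K)%R ->
  (forall t, (0 <= t)%R -> (0 <= P t)%R) -> P 0%R = 0%R ->
  (forall s t, (0 < s)%R -> (s <= t)%R ->
     (P s / s `^ th <= K * (P t / t `^ th))%R) ->
  (forall i, (0 <= d i)%R) -> (forall i, (0 < z i)%R) ->
  (\sum_i z i `^ (1 - th) * P (d i) <=
     2 * K * (\sum_i z i) `^ (1 - th) * P (\sum_i d i))%R.
Proof.
move=> th0 th1 K0 P0 P00 qi d0 z0.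
set W := (\sum_i z i)%R; set D := (\sum_i d i)%R.
have D0 : (0 <= D)%R by exact: sumr_ge0.
have W0 : (0 <= W)%R by apply: sumr_ge0 => i _; exact: ltW.
have dD i : (d i <= D)%R.
  by rewrite /D (bigD1 i)//= lerDl; exact: sumr_ge0.
have zW i : (z i <= W)%R.
  by rewrite /W (bigD1 i)//= lerDl; apply: sumr_ge0 => j _; exact: ltW.
have [DE|DN0] := eqVneq D 0%R.
  rewrite [leLHS]big1.
    by rewrite DE P00 mulr0.
  move=> i _; have -> : d i = 0%R by apply/eqP; rewrite eq_le d0 -DE dD.
  by rewrite P00 mulr0.
have Dgt0 : (0 < D)%R by rewrite lt_neqAle eq_sym DN0.
have term i : (z i `^ (1 - th) * P (d i) <=
    K * W `^ (1 - th) * P D * (d i / D + z i / W))%R.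
  have Wgt0 : (0 < W)%R by exact: lt_le_trans (zW i).
  have Pd : (P (d i) <= K * P D * (d i / D) `^ th)%R.
    have [di0|diN0] := eqVneq (d i) 0%R.
      by rewrite di0 P00 !mulr_ge0 ?powR_ge0 ?P0// ltW.
    have digt0 : (0 < d i)%R by rewrite lt_neqAle eq_sym diN0 d0.
    have := qi _ _ digt0 (dD i).
    rewrite ler_pdivrMr ?powR_gt0// => /le_trans; apply.
    rewrite powRM ?invr_ge0// -(powR_inv1 D0) powRAC (powR_inv1 (powR_ge0 _ _)).
    by rewrite !mulrA mulrAC.
  have zE : (z i `^ (1 - th) = W `^ (1 - th) * (z i / W) `^ (1 - th))%R.
    rewrite -powRM ?divr_ge0 ?(ltW (z0 i))//.
    by rewrite mulrC divfK// gt_eqF.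
  apply: (le_trans (ler_wpM2l (powR_ge0 _ _) Pd)).
  rewrite zE.
  rewrite [leLHS](_ : _ = K * W `^ (1 - th) * P D *
    ((z i / W) `^ (1 - th) * (d i / D) `^ th))%R; last by ring.
  rewrite ler_wpM2l ?mulr_ge0 ?powR_ge0 ?P0 ?(ltW K0)//.
  by apply: powR_interpolation => //; rewrite divr_ge0// ltW.
apply: (le_trans (ler_sum _ (fun i _ => term i))).
rewrite -mulr_sumr big_split/= -!mulr_suml -/D -/W divff//.
rewrite -(mulrA 2%R) -(mulrA 2%R) mulrC.
apply: ler_wpM2r; first by rewrite !mulr_ge0 ?powR_ge0 ?P0// ltW.
rewrite -[leRHS]/(1 + 1)%R lerD2l.
by have [->|?] := eqVneq W 0%R; rewrite ?mul0r// divff.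
Qed.

Section restriction.
Context {R : realType} {n : nat}.
Variables (h : n.-tuple R -> \bar R).
Hypothesis mh : lebesgue_measurable h.
Implicit Types E : set (euclid R n).

Lemma superlevel_restr E (l : R) : (0 <= l)%R ->
  [set x | l%:E < `|h x * (\1_E x)%:E|] = [set x | l%:E < `|h x|] `&` E.
Proof.
move=> l0; apply/seteqP; split => x /=; rewrite indicE.
  case: (boolP (x \in E)) => [/set_mem Ex|_]; first by rewrite mule1.
  by rewrite mule0 abse0 lte_fin ltNge l0.
by move=> [lx Ex]; rewrite mem_set// mule1.
Qed.

Lemma measurable_restr E : measurable E ->
  lebesgue_measurable (fun x => h x * (\1_E x)%:E).
Proof.
move=> mE; apply: emeasurable_funM; first exact: mh.
by apply/measurable_EFinP; exact: measurable_indic.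
Qed.

Lemma superlevel_restr_fin E (l : R) : measurable E ->
  lebesgue_euclid E < +oo -> (0 <= l)%R ->
  lebesgue_euclid [set x | l%:E < `|h x * (\1_E x)%:E|] \is a fin_num.
Proof.
move=> mE Eoo l0; rewrite superlevel_restr// ge0_fin_numE//.
apply: (le_lt_trans _ Eoo); apply: le_measure; rewrite ?inE//.
by apply: measurableI => //; exact: measurable_superlevel.
Qed.

(** A function carried by a set of measure at most [T] has a rearrangement
    that vanishes from [T] on. *)
Lemma lorentz_restr_le E (b : R -> R) (T : R) : weight b -> measurable E ->
  lebesgue_euclid E <= T%:E ->
  \int[@completed_lebesgue_measure R]_(s in `]0%R, +oo[)
     (rearrangement (fun x => h x * (\1_E x)%:E) s * (b s)%:E) <=
  \int[@completed_lebesgue_measure R]_(s in `]0%R, T[)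
     (rearrangement h s * (b s)%:E).
Proof.
move=> wb mE ET; have [_ b0 _] := wb.
have mrb (f : n.-tuple R -> \bar R) :
    measurable_fun (`]0%R, T[ : set (eline R)) (fun s => rearrangement f s * (b s)%:E).
  apply: (@measurable_funS _ _ (eline R) _ `]0%R, +oo[).
  - exact: measurable_itv_eline.
  - by move=> s; rewrite /= !in_itv/= => /andP[->].
  exact: measurable_rearrangement_weight.
have mr := measurable_restr _ mE.
have TE : (`]0%R, T[ : set R)%classic = `]0%R, +oo[ `&` [set s | (s < T)%R].
  apply/seteqP; split => s /=; rewrite !in_itv/= ?andbT.
    by move=> /andP[-> ->].
  by move=> [-> ->].
set r := fun x => h x * (\1_E x)%:E.
have -> : \int[@completed_lebesgue_measure R]_(s in `]0%R, +oo[)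
     (rearrangement r s * (b s)%:E) =
   \int[@completed_lebesgue_measure R]_(s in `]0%R, T[)
     (rearrangement r s * (b s)%:E).
  rewrite TE integral_mkcondr; apply: eq_integral => s _.
  rewrite patchE; case: ifPn => // /negP sT.
  rewrite (_ : rearrangement _ s = 0) ?mul0e//.
  apply/eqP; rewrite eq_le rearrangement_ge0 andbT leNgt lt_rearrangement//.
  rewrite superlevel_restr// -leNgt; apply: (@le_trans _ _ T%:E); last first.
    by rewrite lee_fin leNgt; apply/negP => ?; apply: sT; rewrite inE.
  apply: (le_trans _ ET); apply: le_measure; rewrite ?inE//.
  by apply: measurableI => //; exact: measurable_superlevel.
apply: ge0_le_integral.
- exact: measurable_itv_eline.
- move=> s; rewrite /= in_itv/= => /andP[s0 _].
  exact: rearrangement_weight_ge0.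
- exact: mrb.
- exact: mrb.
- move=> s; rewrite /= in_itv/= => /andP[s0 _].
  apply: lee_wpmul2r; first by rewrite lee_fin b0.
  apply: le_rearrangement; [exact: mr|exact: mh|].
  move=> x; rewrite /r indicE; case: (_ \in _); rewrite ?mule1//.
  by rewrite mule0 abse0 abse_ge0.
Qed.

End restriction.

(** * The lower estimate for the Lorentz functional *)


Lemma primitive_fin {R : realType} (b : R -> R) t : weight b ->
  (forall s, (0 < s)%R -> primitive b s < +oo) -> (0 <= t)%R ->
  primitive b t \is a fin_num.
Proof.
move=> wb boo; rewrite le_eqVlt => /predU1P[<-|t0]; first by rewrite primitive0.
by rewrite ge0_fin_numE ?boo// primitive_ge0.
Qed.

(** The lower [r]-estimate of the Lorentz functional, with [th] standing for
    [alpha / r]. Layer by layer it is the quasi-concavity inequality for [B]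
    evaluated at the measures of the superlevel sets; pairing the pieces with
    the weights [z_i^(1 - th)] makes the estimate linear in the functionals, so
    it can be integrated over the layers. *)
Lemma lorentz_lower_estimate {R : realType} {n N : nat} (b : R -> R)
    (th K T La : R) (h : n.-tuple R -> \bar R)
    (E : 'I_N -> set (euclid R n)) (z : 'I_N -> R) :
  weight b -> (forall t, (0 < t)%R -> primitive b t < +oo) ->
  (0 < th)%R -> (th <= 1)%R -> (0 < K)%R ->
  (forall s t, (0 < s)%R -> (s <= t)%R ->
     (fine (primitive b s) / s `^ th <= K * (fine (primitive b t) / t `^ th))%R) ->
  lebesgue_measurable h ->
  (forall i, measurable (E i)) -> trivIset setT E ->
  \sum_(i < N) lebesgue_euclid (E i) <= T%:E ->
  (forall i, (0 < z i)%R) ->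
  (forall i, (La * z i `^ th)%:E <=
     \int[@completed_lebesgue_measure R]_(s in `]0%R, +oo[)
       (rearrangement (fun x => h x * (\1_(E i) x)%:E) s * (b s)%:E)) ->
  (La * (\sum_i z i) `^ th)%:E <=
    (2 * K)%:E * \int[@completed_lebesgue_measure R]_(s in `]0%R, T[)
      (rearrangement h s * (b s)%:E).
Proof.
move=> wb boo th0 th1 K0 qi mh mE tE ET z0 La_le.
set W := (\sum_i z i)%R; set A := \int[_]_(s in _) _.
have A0 : 0 <= A by exact: integral_rearrangement_ge0.
have W0 : (0 <= W)%R by apply: sumr_ge0 => i _; exact: ltW.
have [->|WN0] := eqVneq W 0%R.
  by rewrite powR0 ?gt_eqF// mulr0 mule_ge0// lee_fin mulr_ge0// ltW.
have Wgt0 : (0 < W)%R by rewrite lt_neqAle eq_sym WN0.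
pose U := \big[setU/set0]_(i < N) E i.
have mU : measurable U by exact: bigsetU_measurable.
have UT : lebesgue_euclid U <= T%:E by rewrite measure_semi_additive_ord.
have Eoo i : lebesgue_euclid (E i) < +oo.
  apply: le_lt_trans (ltry T); apply: le_trans ET.
  by rewrite (bigD1 i)//= leeDl//; apply: sume_ge0.
have Uoo : lebesgue_euclid U < +oo by apply: le_lt_trans (ltry T).
pose d i l := fine (lebesgue_euclid [set x | l%:E < `|h x * (\1_(E i) x)%:E|]).
pose D l := fine (lebesgue_euclid [set x | l%:E < `|h x * (\1_U x)%:E|]).
have d0 i l : (0 <= d i l)%R by exact/fine_ge0.
have DE l : (0 < l)%R -> D l = (\sum_i d i l)%R.
  move=> l0; apply: EFin_inj; rewrite -sumEFin.
  rewrite fineK; last by apply: superlevel_restr_fin => //; exact: ltW.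
  rewrite superlevel_restr ?(ltW l0)// /U big_distrr/= measure_semi_additive_ord.
  - apply: eq_bigr => i _; rewrite fineK; last first.
      by apply: superlevel_restr_fin => //; exact: ltW.
    by rewrite superlevel_restr// ltW.
  - by move=> i; apply: measurableI => //; exact: measurable_superlevel.
  - by apply: trivIset_setIl.
  - apply: bigsetU_measurable => i _; apply: measurableI => //.
    exact: measurable_superlevel.
have layer (F : set (euclid R n)) : measurable F -> lebesgue_euclid F < +oo ->
    \int[@completed_lebesgue_measure R]_(s in `]0%R, +oo[)
       (rearrangement (fun x => h x * (\1_F x)%:E) s * (b s)%:E) =
    \int[@lebesgue_measure R]_(l in `]0%R, +oo[)
      primitive b (fine (lebesgue_euclid [set x | l%:E < `|h x * (\1_F x)%:E|])).
  move=> mF Foo; apply: lorentz_layer_cake => //; first exact: measurable_restr.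
  by move=> l l0; apply: superlevel_restr_fin => //; exact: ltW.
have mlayer (F : set (euclid R n)) : measurable F -> lebesgue_euclid F < +oo ->
    measurable_fun (`]0%R, +oo[ : set (measurableTypeR R)) (fun l =>
      primitive b (fine (lebesgue_euclid [set x | l%:E < `|h x * (\1_F x)%:E|]))).
  move=> mF Foo; apply: measurable_lorentz_layer => //; first exact: measurable_restr.
  by move=> l l0; apply: superlevel_restr_fin => //; exact: ltW.
have mD : measurable (`]0%R, +oo[%classic : set (measurableTypeR R)).
  exact: measurable_itv.
(* as [z_i = z_i^(1-th) z_i^th], [La W] is the combination with coefficients
   [z_i^(1-th)] of the left sides of the hypotheses *)
suff main : (La * W)%:E <= (2 * K * W `^ (1 - th))%:E * A.
  have -> : (La * W `^ th = (W `^ (1 - th))^-1 * (La * W))%R.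
    rewrite -powRN opprB powRB ?WN0 ?implybT// powRr1//.
    by rewrite mulrCA divfK.
  rewrite EFinM; apply: (le_trans (lee_wpmul2l _ main)).
    by rewrite lee_fin invr_ge0 powR_ge0.
  rewrite muleA -EFinM [X in X%:E * _](_ : _ = 2 * K)%R//.
  by rewrite mulrC mulfK// gt_eqF// powR_gt0.
have -> : (La * W)%:E = \sum_i (z i `^ (1 - th))%:E * (La * z i `^ th)%:E.
  rewrite /W mulr_sumr -sumEFin; apply: eq_bigr => i _.
  rewrite -EFinM mulrCA -powRD; last by rewrite (gt_eqF (z0 i)) implybT.
  by rewrite subrK powRr1// ltW.
apply: (@le_trans _ _ (\sum_i \int[@lebesgue_measure R]_(l in `]0%R, +oo[)
    ((z i `^ (1 - th))%:E * primitive b (d i l)))).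
  apply: lee_sum => i _; rewrite ge0_integralZl.
  - apply: lee_wpmul2l; first by rewrite lee_fin powR_ge0.
    rewrite -(layer _ (mE i) (Eoo i)); exact: La_le.
  - exact: mD.
  - exact: mlayer.
  - by move=> l _; exact: primitive_ge0.
  - by rewrite lee_fin powR_ge0.
rewrite -ge0_integral_sum; last 3 first.
- exact: mD.
- move=> i; apply: emeasurable_funM; last exact: mlayer.
  exact: measurable_cst.
- by move=> i l _; rewrite mule_ge0 ?primitive_ge0// lee_fin powR_ge0.
apply: (@le_trans _ _ (\int[@lebesgue_measure R]_(l in `]0%R, +oo[)
    ((2 * K * W `^ (1 - th))%:E * primitive b (D l)))).
  apply: ge0_le_integral.
  - exact: mD.
  - move=> l _; apply: sume_ge0 => i _.
    by rewrite mule_ge0 ?primitive_ge0// lee_fin powR_ge0.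
  - apply: emeasurable_sum => i; apply: emeasurable_funM; last exact: mlayer.
    exact: measurable_cst.
  - apply: emeasurable_funM; last exact: mlayer.
    exact: measurable_cst.
  - move=> l; rewrite /= in_itv/= andbT => l0.
    have fin t : (0 <= t)%R -> primitive b t = (fine (primitive b t))%:E.
      by move=> t0; rewrite fineK// primitive_fin.
    rewrite (fin (D l)); last by exact/fine_ge0.
    under eq_bigr do rewrite fin// -EFinM.
    rewrite sumEFin -EFinM lee_fin DE//.
    apply: (weighted_sum_quasi_concave (fun t => fine (primitive b t))) => //.
    + exact: ltW.
    + by move=> t _; apply: fine_ge0; exact: primitive_ge0.
    + by rewrite primitive0.
rewrite ge0_integralZl; last 4 first.
- exact: mD.
- exact: mlayer.
- by move=> l _; exact: primitive_ge0.
- by rewrite lee_fin !mulr_ge0 ?powR_ge0// ltW.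
apply: lee_wpmul2l; first by rewrite lee_fin !mulr_ge0 ?powR_ge0// ltW.
rewrite -(layer _ mU Uoo); exact: lorentz_restr_le.
Qed.

(** * Vitali covering by cubes *)


Lemma measurable_open_cube {R : realType} {n : nat} (a : n.-tuple R) (l : R) :
  measurable (open_cube a l : set (euclid R n)).
Proof.
apply: sub_caratheodory => /=; apply: sub_sigma_algebra.
have -> : open_cube a l = \bigcap_(i in [set: 'I_n])
    ((fun x : n.-tuple (measurableTypeR R) => tnth x i) @^-1`
       `]tnth a i, (tnth a i + l)%R[).
  by apply/seteqP; split => x H i; [move=> _|]; rewrite ?/= ?in_itv/=; [exact: H|
    have := H i I; rewrite /= in_itv].
apply: fin_bigcap_measurable => // i _; rewrite -[X in measurable X]setTI.
by apply: measurable_tnth => //; exact: measurable_itv.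
Qed.

Section cubes.
Context {R : realType} {n : nat}.
Implicit Types c d : (n.-tuple R * R)%type.

Definition cube c : set (euclid R n) := open_cube c.1 c.2.

Definition triple c : n.-tuple R * R :=
  ([tuple (tnth c.1 i - c.2)%R | i < n], (3 * c.2)%R).

Definition disjoint_cubes c d := `[< cube c `&` cube d = set0 >].

Lemma cube_subset_triple c : (0 < c.2)%R -> cube c `<=` cube (triple c).
Proof.
by move=> c0 y yc i; have := yc i; rewrite /triple/= tnth_mktuple => yi; lra.
Qed.

Lemma meeting_cube_subset_triple c d : ~~ disjoint_cubes c d ->
  (c.2 <= d.2)%R -> cube c `<=` cube (triple d).
Proof.
move=> /asboolPn/eqP/set0P[x [xc xd]] cd y yc i.
have := xc i; have := xd i; have := yc i.
by rewrite /triple/= tnth_mktuple => yci xdi xci; lra.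
Qed.

(** Finite Vitali selection. Going through the cubes from the largest side to
    the smallest, a cube is kept if it meets none of the cubes kept before;
    otherwise it meets one that is at least as large and is swallowed by its
    triple. *)
Lemma vitali_selection (cs : seq (n.-tuple R * R)) :
  (forall c, c \in cs -> (0 < c.2)%R) ->
  exists ds : seq (n.-tuple R * R), [/\ {subset ds <= cs},
    pairwise disjoint_cubes ds &
    forall c, c \in cs -> exists2 d, d \in ds & cube c `<=` cube (triple d)].
Proof.
pose le_side (c d : n.-tuple R * R) := (c.2 <= d.2)%R.
wlog cs_sorted : cs / sorted le_side cs.
  move=> wl cs0.
  have [|c|ds [dscs ds_disj cover]] := wl (sort le_side cs).
  - by apply: sort_sorted => c d; exact: le_total.
  - by rewrite mem_sort; exact: cs0.
  - exists ds; split => // [d /dscs|c ccs]; first by rewrite mem_sort.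
    by apply: cover; rewrite mem_sort.
elim: cs cs_sorted => [_ _|c cs IH /= csorted cs0]; first by exists [::]; split.
have [|d dcs|ds [dscs ds_disj cover]] := IH.
- exact: path_sorted csorted.
- by apply: cs0; rewrite in_cons dcs orbT.
have le_tr : transitive le_side by move=> x y z; exact: le_trans.
have /allP cmin := order_path_min le_tr csorted.
have [disj|/allPn[d dds cd]] := boolP (all (disjoint_cubes c) ds).
- exists (c :: ds); split => /=; last 2 first.
  + by rewrite disj.
  + move=> e; rewrite in_cons => /predU1P[->|/cover[d dds ed]].
      exists c; rewrite ?mem_head//.
      by apply: cube_subset_triple; apply: cs0; rewrite mem_head.
    by exists d => //; rewrite in_cons dds orbT.
  + move=> d; rewrite !in_cons => /predU1P[->|/dscs ->]; rewrite ?eqxx ?orbT//.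
- exists ds; split => // [e /dscs|e]; first by rewrite in_cons orbC => ->.
  rewrite in_cons => /predU1P[->|/cover//]; exists d => //.
  by apply: meeting_cube_subset_triple cd _; apply: cmin; exact: dscs.
Qed.

Lemma lebesgue_cover_triple (ds : seq (n.-tuple R * R)) (A : set (euclid R n)) :
  (forall d, d \in ds -> (0 < d.2)%R) ->
  (forall x, A x -> exists2 d, d \in ds & cube (triple d) x) ->
  lebesgue_euclid A <= (3 ^+ n * \sum_(d <- ds) d.2 ^+ n)%:E.
Proof.
elim: ds A => [|d ds IH] A ds0 Acover.
  rewrite big_nil mulr0; have -> : A = set0.
    by rewrite -subset0 => x /Acover[].
  by rewrite measure0.
pose A' := [set x : euclid R n | exists2 e, e \in ds & cube (triple e) x].
have A'E : A' = \bigcup_(e in [set` ds]) cube (triple e).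
  by apply/seteqP; split => x [e eds ex]; exists e.
have mA' : measurable A'.
  rewrite A'E; apply: fin_bigcup_measurable => // e _.
  exact: measurable_open_cube.
have mT : measurable (cube (triple d)) by exact: measurable_open_cube.
apply: (@le_trans _ _ (lebesgue_euclid (cube (triple d) `|` A'))).
  apply: le_mu_ext => x /Acover[e]; rewrite in_cons => /predU1P[->|eds ex].
    by left.
  by right; exists e.
apply: (@le_trans _ _ (lebesgue_euclid (cube (triple d)) + lebesgue_euclid A')).
  exact: measureU2.
rewrite big_cons mulrDr EFinD [X in X + _]lebesgue_open_cube; last first.
  by rewrite mulr_gt0// ds0// mem_head.
rewrite /= exprMn leeD2l//.
apply: IH => //.
by move=> e eds; apply: ds0; rewrite in_cons eds orbT.
Qed.

(** A countable stock of cubes, fine enough to sit inside any given cube around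
    any of its points; it replaces compactness in the covering argument. *)
Definition grid_cube (k : nat) (z : n.-tuple int) : n.-tuple R * R :=
  ([tuple ((tnth z i)%:~R - 1) / k.+1%:R | i < n], (2 / k.+1%:R))%R.

Lemma grid_cube_refines c x : cube c x ->
  exists k z, cube (grid_cube k z) x /\ cube (grid_cube k z) `<=` cube c.
Proof.
move=> xc.
pose gap i := Num.min (tnth x i - tnth c.1 i)%R (tnth c.1 i + c.2 - tnth x i)%R.
pose e := \big[Num.min/1%R]_(i < n) gap i.
have e0 : (0 < e)%R.
  apply: lt_bigmin => // i _; rewrite /gap lt_min !subr_gt0.
  exact: xc.
have egap i : (e <= gap i)%R by exact: bigmin_le_cond.
have [k] : exists k : nat, (k.+1%:R^-1 < e / 2)%R.
  by have [k] := ltr_add_invr (divr_gt0 e0 (ltr0Sn _ 1)); rewrite add0r; exists k.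
have k0 : (0 < k.+1%:R :> R)%R by [].
move=> ke; pose z : n.-tuple int := [tuple Num.floor (tnth x i * k.+1%:R)%R | i < n].
pose gridpt i := ((tnth z i)%:~R / k.+1%:R : R)%R; pose v := (k.+1%:R^-1 : R)%R.
have zx i : ((tnth z i)%:~R / k.+1%:R <= tnth x i <
             (tnth z i)%:~R / k.+1%:R + k.+1%:R^-1)%R.
  rewrite -[X in (_ + X)%R]mul1r -mulrDl ler_pdivrMr// ltr_pdivlMr// tnth_mktuple.
  by have := floor_itv (tnth x i * k.+1%:R)%R; rewrite intrD.
exists k, z; split.
  move=> i; rewrite /grid_cube/= tnth_mktuple mulrBl mul1r; have := zx i.
  have : (0 < k.+1%:R^-1 :> R)%R by rewrite invr_gt0.
  rewrite -/(gridpt i) -/v => v0 /andP[? ?]; apply/andP; split; lra.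
move=> y yz i; have := yz i; rewrite /grid_cube/= tnth_mktuple mulrBl mul1r.
have := zx i; have := egap i; rewrite /gap le_min.
move: ke; rewrite -/(gridpt i) -/v => ? /andP[? ?] /andP[? ?] /andP[? ?].
by apply/andP; split; lra.
Qed.

(** The union of a family of cubes is exhausted by the countably many grid cubes
    contained in members of the family, so finitely many of these already carry
    measure more than [t]; the selected cubes then do so after tripling. *)
Lemma vitali_covering (B : set (n.-tuple R * R)) (t : R) :
  (forall c, B c -> (0 < c.2)%R) ->
  t%:E < lebesgue_euclid [set x | exists2 c, B c & cube c x] ->
  exists ds : seq (n.-tuple R * R), [/\ forall d, d \in ds -> B d,
    pairwise disjoint_cubes ds & (t < 3 ^+ n * \sum_(d <- ds) d.2 ^+ n)%R].
Proof.
move=> B0 tB.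
pose F j : set (euclid R n) := if unpickle j is Some (k, z) then
  [set x | cube (grid_cube k z) x /\
     exists2 c, B c & cube (grid_cube k z) `<=` cube c] else set0.
have mF j : measurable (F j).
  rewrite /F; case: (unpickle j) => [[k z]|//].
  have [Bz|Bz] := pselect (exists2 c, B c & cube (grid_cube k z) `<=` cube c).
    rewrite (_ : [set _ | _] = cube (grid_cube k z)); first exact: measurable_open_cube.
    by apply/seteqP; split => x // [].
  rewrite (_ : [set _ | _] = set0)//.
  by rewrite -subset0 => x [].
pose V N := \bigcup_(j in `I_N) F j.
have mV N : measurable (V N) by apply: bigcup_measurable.
have VE : \bigcup_N V N = [set x | exists2 c, B c & cube c x].
  apply/seteqP; split => x.
    move=> [N _ [j _]]; rewrite /F; case: (unpickle j) => [[k z]|//].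
    by move=> [xz [c Bc zc]]; exists c => //; exact: zc.
  move=> [c Bc xc]; have [k [z [xz zc]]] := grid_cube_refines _ _ xc.
  exists (pickle (k, z)).+1 => //; exists (pickle (k, z)) => /=; first exact: ltnSn.
  by rewrite /F pickleK; split => //; exists c.
have ndV : nondecreasing_seq V.
  move=> i j ij; apply/subsetPset => x [k /= ki Fk]; exists k => //=.
  exact: leq_trans ij.
have /= cvgV := nondecreasing_cvg_mu (mu := @lebesgue_euclid R n) mV
  (bigcup_measurable (fun k _ => mV k)) ndV.
have [N tN] : exists N, t%:E < lebesgue_euclid (V N).
  apply: contrapT => no.
  move: tB; rewrite ltNge => /negP; apply; rewrite -VE -(cvg_lim _ cvgV)//.
  apply: lime_le; first by apply/cvg_ex; eexists; exact: cvgV.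
  by apply: nearW => k /=; rewrite leNgt; apply/negP => tk; apply: no; exists k.
have [cs [csB Vcs]] : exists cs : seq (n.-tuple R * R),
    (forall c, c \in cs -> B c) /\
    forall x, V N x -> exists2 c, c \in cs & cube c x.
  elim: N {tN} => [|N [cs [csB Vcs]]].
    by exists [::]; split => // x [].
  have VS x : V N.+1 x -> V N x \/ F N x.
    move=> [j /=]; rewrite ltnS leq_eqVlt => /predU1P[->|jN] Fj; first by right.
    by left; exists j.
  have [[c Bc FNc]|FN0] := pselect (exists2 c, B c & F N `<=` cube c).
    exists (c :: cs); split => [d|x /VS[/Vcs[d dcs xd]|/FNc xc]].
    - by rewrite in_cons => /predU1P[->|/csB].
    - by exists d => //; rewrite in_cons dcs orbT.
    - by exists c => //; rewrite mem_head.
  exists cs; split => // x /VS[/Vcs//|FNx]; exfalso; apply: FN0.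
  move: FNx; rewrite /F; case: (unpickle N) => [[k z]|//] [xz [c Bc zc]].
  by exists c => // y [yz _]; exact: zc.
have [c ccs|ds [dscs ds_disj cover]] := vitali_selection cs.
  by apply: B0; exact: csB.
exists ds; split => // [d /dscs/csB//|].
rewrite -lte_fin; apply: (lt_le_trans tN); apply: lebesgue_cover_triple.
  by move=> d /dscs/csB/B0.
move=> x /Vcs[c /cover[d dds cd] xc]; exists d => //; exact: cd.
Qed.

End cubes.

(** * The rearranged maximal function from above *)


Lemma Qclass_dilation {R : realType} (r : R) (phi : R -> R) (N : nat) :
  (0 < r)%R -> (forall t, (0 < t)%R -> (0 < phi t)%R) -> Qclass r phi ->
  exists2 C : R, (0 < C)%R &
    forall t, (0 < t)%R -> (phi (N.+1%:R * t) <= C * phi t)%R.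
Proof.
move=> r0 phi0 [C C0 HC]; exists (C * N.+1%:R `^ r^-1)%R.
  by rewrite mulr_gt0// powR_gt0.
move=> t t0; have := HC N (fun=> t) (fun=> t0).
rewrite !sumr_const card_ord -(mulr_natl t) -(mulr_natl (phi t `^ r)%R).
rewrite powRM ?powR_ge0// -powRrM mulfV ?gt_eqF// powRr1 ?(ltW (phi0 _ t0))//.
by rewrite mulrA.
Qed.

Section sup_operator_profile.
Context {R : realType} {n : nat}.
Variables (alpha : R) (phi b : R -> R) (h : n.-tuple R -> \bar R).
Local Notation mu := (@completed_lebesgue_measure R).
Hypotheses (wb : weight b) (phi0 : forall t, (0 < t)%R -> (0 < phi t)%R).
Hypothesis Bfin : forall t, (0 < t)%R -> 0 < primitive b t < +oo.

(** The operator [T_{B/phi^alpha,b}] applied to [h^*] is the supremum of this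
    quantity over [tau >= t], the two factors [B] cancelling. *)
Definition profile (tau : R) : \bar R :=
  ((phi tau `^ alpha)^-1)%:E *
  \int[mu]_(s in `]0%R, tau[) (rearrangement h s * (b s)%:E).

Local Notation S :=
  (sup_operator (fun t => fine (primitive b t) / phi t `^ alpha)%R b
     (rearrangement h)).

Lemma profile_ge0 tau : 0 <= profile tau.
Proof.
by rewrite mule_ge0 ?integral_rearrangement_ge0// lee_fin invr_ge0 powR_ge0.
Qed.

Let profileE tau : (0 < tau)%R ->
  (fine (primitive b tau) / phi tau `^ alpha / fine (primitive b tau))%:E *
  \int[mu]_(s in `]0%R, tau[) (rearrangement h s * (b s)%:E) = profile tau.
Proof.
move=> t0; rewrite /profile; congr (_%:E * _).
have /andP[B0 Boo] := Bfin _ t0.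
have Bn0 : fine (primitive b tau) != 0%R.
  by rewrite gt_eqF// fine_gt0// B0.
by rewrite mulrAC divff// mul1r.
Qed.

Lemma profile_le_sup_operator t tau : (0 < t)%R -> (t <= tau)%R ->
  profile tau <= S t.
Proof.
move=> t0 ttau; rewrite -profileE; last exact: lt_le_trans ttau.
by apply: ereal_sup_ubound; exists tau => //=; rewrite in_itv/= andbT.
Qed.

Lemma sup_operator_le t (y : \bar R) : (0 < t)%R ->
  (forall tau, (t <= tau)%R -> profile tau <= y) -> S t <= y.
Proof.
move=> t0 Gy; apply: ge_ereal_sup => _ [tau + <-].
rewrite /= in_itv/= andbT => ttau.
by rewrite profileE ?Gy//; exact: lt_le_trans ttau.
Qed.

Lemma sup_operator_ge0 t : (0 < t)%R -> 0 <= S t.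
Proof.
move=> t0; apply: le_trans (profile_le_sup_operator _ _ t0 (lexx t)).
exact: profile_ge0.
Qed.

Lemma sup_operator_nincr s t : (0 < s)%R -> (s <= t)%R -> S t <= S s.
Proof.
move=> s0 st; apply: sup_operator_le; first exact: lt_le_trans st.
by move=> tau ttau; apply: profile_le_sup_operator => //; exact: le_trans ttau.
Qed.

(** Under dilation [phi] grows by at most a constant factor, while the integral
    does not decrease. *)
Lemma profile_dilation (N : nat) (C : R) : (0 <= alpha)%R -> (0 < C)%R ->
  (forall t, (0 < t)%R -> (phi (N.+1%:R * t) <= C * phi t)%R) ->
  forall t, (0 < t)%R -> profile t <= (C `^ alpha)%:E * profile (N.+1%:R * t)%R.
Proof.
move=> a0 C0 HC t t0; rewrite /profile muleA -EFinM.
have Nt0 : (0 < N.+1%:R * t)%R by rewrite mulr_gt0.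
apply: lee_pmul.
- by rewrite lee_fin invr_ge0 powR_ge0.
- exact: integral_rearrangement_ge0.
- rewrite lee_fin ler_pdivlMr ?powR_gt0 ?phi0//.
  rewrite mulrC ler_pdivrMr ?powR_gt0 ?phi0// -powRM ?(ltW C0) ?(ltW (phi0 _ _))//.
  by apply: ge0_ler_powR; rewrite ?nnegrE ?HC ?mulr_ge0 ?(ltW C0) ?(ltW (phi0 _ _)).
- by apply: le_integral_rearrangement => //; rewrite ler_peMl ?(ltW t0)// ler1n.
Qed.

End sup_operator_profile.

Lemma lorentz_norm_powE {R : realType} {n : nat} (alpha : R) (b : R -> R)
    (f : n.-tuple R -> \bar R) (E : set (euclid R n)) :
  (0 < alpha)%R -> lebesgue_measurable f -> measurable E ->
  lorentz_norm alpha b (fun y => f y * (\1_E y)%:E) =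
  (\int[@completed_lebesgue_measure R]_(s in `]0%R, +oo[)
     (rearrangement (fun y => `|f y| `^ alpha * (\1_E y)%:E) s
        * (b s)%:E)) `^ alpha^-1.
Proof.
move=> a0 mf mE; rewrite /lorentz_norm; congr (_ `^ _).
have -> : (fun y => `|f y| `^ alpha * (\1_E y)%:E) =
    (fun y => `|f y * (\1_E y)%:E| `^ alpha).
  apply/funext => y; rewrite indicE; case: (y \in E); rewrite ?mule1//.
  by rewrite !mule0 abse0 poweR0r// gt_eqF.
apply: eq_integral => s _.
by rewrite (rearrangement_poweR _ _ (measurable_restr _ mf _ mE) a0).
Qed.

Lemma maximal_fun_ge0 {R : realType} {n : nat} (alpha : R) (phi b : R -> R)
    (f : n.-tuple R -> \bar R) x :
  (forall t, (0 < t)%R -> (0 < phi t)%R) -> 0 <= maximal_fun phi alpha b f x.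
Proof.
move=> phi0; pose a := [tuple (tnth x i - 1)%R | i < n].
apply: le_ereal_sup_tmp.
exists (lorentz_norm alpha b (fun y => f y * (\1_(open_cube a 2) y)%:E) *
  ((phi (fine (lebesgue_euclid (open_cube a 2))))^-1)%:E).
  exists (open_cube a 2) => //; split; first by exists a, 2%R.
  by move=> i; rewrite tnth_mktuple; apply/andP; split; lra.
apply: mule_ge0; first exact: poweR_ge0.
by rewrite lee_fin invr_ge0 ltW// phi0// lebesgue_open_cube//= exprn_gt0.
Qed.

(** If the maximal function exceeds [l] on a set of measure more than [t], select
    disjoint cubes [Q_i] with [l phi(|Q_i|) < ||f chi_{Q_i}||] whose total measure
    [T] exceeds [t / 3^n]. The lower estimate for the Lorentz functional against
    the [Q_r] condition for [phi] turns this into [l phi(T) <= C ||f^* chi_(0,T)||],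
    and passing from [T] to [3^n T > t] costs only a constant. *)
Lemma rearrangement_maximal_le {R : realType} (n : nat) (alpha r : R)
    (phi b : R -> R) :
  (0 < alpha)%R -> (alpha <= r)%R ->
  (forall t, (0 < t)%R -> (0 < phi t)%R) -> Qclass r phi -> weight b ->
  (forall t, (0 < t)%R -> 0 < primitive b t < +oo) ->
  quasi_increasing (fun t => fine (primitive b t) / t `^ (alpha / r))%R ->
  exists2 C : R, (0 < C)%R &
    forall f : n.-tuple R -> \bar R, lebesgue_measurable f ->
    forall t, (0 < t)%R ->
      rearrangement (maximal_fun phi alpha b f) t <=
      C%:E * (sup_operator (fun t => fine (primitive b t) / phi t `^ alpha)%R b
        (rearrangement (fun x => `|f x| `^ alpha)) t) `^ alpha^-1.
Proof.
move=> a0 ar phi0 Qphi wb Bfin [K K0 qi].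
have r0 : (0 < r)%R by exact: lt_le_trans ar.
have [C1 C10 HC1] := Qphi.
(* dilation by [3^n], the volume ratio of a cube and its triple *)
have [C2 C20 HC2] := Qclass_dilation _ _ (3 ^ n).-1 r0 phi0 Qphi.
have n3 : ((3 ^ n).-1.+1 = 3 ^ n)%N by rewrite prednK// expn_gt0.
rewrite n3 in HC2.
pose C3 : R := (C1 `^ alpha * (2 * K) * C2 `^ alpha)%R.
have C30 : (0 < C3)%R by rewrite !mulr_gt0 ?powR_gt0.
exists (C3 `^ alpha^-1)%R; first by rewrite powR_gt0.
move=> f mf t t0; set h := fun x => `|f x| `^ alpha.
have mh : lebesgue_measurable h by exact: measurable_abse_powR.
set S := sup_operator _ _ _ _.
have S0 : 0 <= S by exact: sup_operator_ge0.
apply: le_of_real_lt; first by rewrite mule_ge0 ?poweR_ge0// lee_fin powR_ge0.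
move=> l l0 /(lt_superlevel_of_lt_rearrangement _ _ _ l0) tl.
pose B : set (n.-tuple R * R) := [set c | (0 < c.2)%R /\
  (l * phi (c.2 ^+ n))%:E < lorentz_norm alpha b (fun y => f y * (\1_(cube c) y)%:E)].
have tB : t%:E < lebesgue_euclid [set x | exists2 c, B c & cube c x].
  apply: (lt_le_trans tl); apply: le_mu_ext => x /=.
  rewrite gee0_abs; last exact: maximal_fun_ge0.
  move=> /ereal_sup_gt[_ [Q [[a [s [s0 ->]]] xQ] <-]] lQ.
  exists (a, s) => //; split => //=.
  move: lQ; rewrite lebesgue_open_cube//= lte_pdivlMr// phi0// exprn_gt0//.
have [|ds [dsB ds_disj tT]] := vitali_covering B t _ tB.
  by move=> c [].
set T := (\sum_(d <- ds) d.2 ^+ n)%R in tT.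
have T0 : (0 < T)%R.
  by rewrite -(pmulr_rgt0 _ (exprn_gt0 n (ltr0Sn R 2))) (lt_trans t0).
have [d0 dsE] : exists d0, ds = d0 :: behead ds.
  case: (ds) @T T0 {tT dsB ds_disj} => [|d0 ds'] /=; last by exists d0.
  by rewrite big_nil ltxx.
pose N := (size (behead ds)).
have szds : size ds = N.+1 by rewrite dsE.
pose Q (i : 'I_N.+1) := nth d0 ds i.
have dsQ i : Q i \in ds by rewrite mem_nth// szds.
have Qside i : (0 < (Q i).2)%R by have [] := dsB _ (dsQ i).
pose vol i := ((Q i).2 ^+ n)%R.
have vol0 i : (0 < vol i)%R by rewrite exprn_gt0.
have TE : (T = \sum_i vol i)%R by rewrite /T (big_nth d0) szds big_mkord.
have tQ : trivIset setT (cube \o Q).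
  have disj (i j : 'I_N.+1) : (i < j)%N -> (cube \o Q) i `&` (cube \o Q) j = set0.
    move=> ij; apply/asboolP; move/(pairwiseP d0) : ds_disj; apply => //.
    - by rewrite inE szds.
    - by rewrite inE szds.
  apply/trivIsetP => i j _ _; rewrite neq_ltn => /orP[ij|ji]; first exact: disj.
  by rewrite setIC; exact: disj.
(* with [z_i = phi(|Q_i|)^r] the powers [z_i^(alpha/r)] are [phi(|Q_i|)^alpha] *)
have est := lorentz_lower_estimate b (alpha / r) K T (l `^ alpha) h (cube \o Q)
  (fun i => phi (vol i) `^ r)%R wb.
have {}est : (l `^ alpha * (\sum_i phi (vol i) `^ r) `^ (alpha / r))%:E <=
    (2 * K)%:E * \int[@completed_lebesgue_measure R]_(s in `]0%R, T[)
      (rearrangement h s * (b s)%:E).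
  apply: est => //.
  - by move=> s s0; have /andP[] := Bfin _ s0.
  - by rewrite divr_gt0.
  - by rewrite ler_pdivrMr// mul1r.
  - by move=> i; exact: measurable_open_cube.
  - rewrite TE -sumEFin; apply: lee_sum => i _.
    by rewrite [leLHS]lebesgue_open_cube.
  - by move=> i; rewrite powR_gt0// phi0.
  - move=> i; have [_] := dsB _ (dsQ i).
    rewrite lorentz_norm_powE//; last exact: measurable_open_cube.
    rewrite lt_poweR_root ?invr_gt0 ?mulr_ge0 ?(ltW (phi0 _ _))//; last 2 first.
      exact: vol0.
      apply: integral_ge0 => s; rewrite /= in_itv/= andbT => s0.
      exact: rearrangement_weight_ge0.
    rewrite invrK powRM ?(ltW (phi0 _ (vol0 _)))// => /ltW.
    by rewrite -powRrM mulrCA mulfV ?mulr1// gt_eqF.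
have phiT : (phi T `^ alpha <=
    C1 `^ alpha * (\sum_i phi (vol i) `^ r) `^ (alpha / r))%R.
  have := HC1 N vol vol0; rewrite -TE => phiT.
  apply: (@le_trans _ _ ((C1 * (\sum_i phi (vol i) `^ r) `^ r^-1) `^ alpha)%R).
    by apply: ge0_ler_powR; rewrite ?nnegrE ?(ltW a0) ?mulr_ge0 ?powR_ge0
      ?(ltW C10) ?(ltW (phi0 _ T0)).
  by rewrite powRM ?powR_ge0 ?(ltW C10)// -powRrM (mulrC alpha).
have lG : (l `^ alpha)%:E <= (C1 `^ alpha * (2 * K))%:E * profile alpha phi b h T.
  rewrite /profile muleCA EFinM -muleA.
  have -> : (l `^ alpha)%:E =
      ((phi T `^ alpha)^-1)%:E * ((phi T `^ alpha)%:E * (l `^ alpha)%:E).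
    by rewrite -!EFinM mulKf// gt_eqF// powR_gt0// phi0.
  apply: lee_wpmul2l; first by rewrite lee_fin invr_ge0 powR_ge0.
  apply: (@le_trans _ _ ((C1 `^ alpha)%:E *
    (l `^ alpha * (\sum_i phi (vol i) `^ r) `^ (alpha / r))%:E)).
    rewrite -!EFinM lee_fin mulrCA (mulrC (phi T `^ alpha)%R).
    by apply: ler_wpM2l => //; exact: powR_ge0.
  by rewrite lee_wpmul2l// lee_fin powR_ge0.
have {}lG : (l `^ alpha)%:E <= C3%:E * S.
  apply: (le_trans lG); rewrite /C3 [in leRHS]EFinM -muleA.
  apply: lee_wpmul2l.
    by rewrite lee_fin !mulr_ge0 ?powR_ge0// ltW.
  apply: (le_trans (profile_dilation _ _ _ _ wb phi0 (3 ^ n).-1 C2 (ltW a0) C20 _ _ T0)).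
    by rewrite n3.
  rewrite n3 lee_wpmul2l ?lee_fin ?powR_ge0//.
  apply: profile_le_sup_operator => //.
  by rewrite natrX ltW.
have := @le_poweR R alpha^-1 (l `^ alpha)%:E (C3%:E * S).
rewrite invr_ge0 (ltW a0) lee_fin powR_ge0 => /(_ isT isT lG).
rewrite poweR_EFin -powRrM mulfV ?gt_eqF// powRr1// poweRM//.
by rewrite lee_fin ltW.
Qed.

(** * The rearranged maximal function from below *)


Section cubic_volume.
Context {R : realType} {n : nat}.
Hypothesis n0 : (0 < n)%N.

(** The volume of the smallest closed cube centred at the origin that contains
    [x]. *)
Definition cubic_volume (x : n.-tuple R) : R :=
  ((2 * \big[Num.max/0]_(i < n) `|tnth x i|) ^+ n)%R.

Definition centred_cube (s : R) : set (euclid R n) :=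
  open_cube [tuple (- (s `^ n%:R^-1 / 2))%R | i < n] (s `^ n%:R^-1)%R.

Let root_pow (s : R) : (0 <= s)%R -> ((s `^ n%:R^-1) ^+ n = s)%R.
Proof.
move=> s0; rewrite -powR_mulrn ?powR_ge0// -powRrM mulVf ?powRr1//.
by rewrite pnatr_eq0 -lt0n.
Qed.

Lemma lebesgue_centred_cube s : (0 < s)%R ->
  lebesgue_euclid (centred_cube s) = s%:E.
Proof.
by move=> s0; rewrite /centred_cube lebesgue_open_cube ?powR_gt0// root_pow// ltW.
Qed.

Lemma cubic_volume_ge0 x : (0 <= cubic_volume x)%R.
Proof. by rewrite exprn_ge0// mulr_ge0// bigmax_ge_id. Qed.

Lemma cubic_volume_lt s : (0 < s)%R ->
  [set x | (cubic_volume x < s)%R] = centred_cube s.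
Proof.
move=> s0; pose c := (s `^ n%:R^-1 / 2)%R.
have c0 : (0 < c)%R by rewrite divr_gt0// powR_gt0.
have cE : (s `^ n%:R^-1)%R = (2 * c)%R by rewrite /c mulrC divfK.
have E x : (cubic_volume x < s)%R = (\big[Num.max/0]_(i < n) `|tnth x i| < c)%R.
  rewrite -[in LHS](root_pow _ (ltW s0)) /cubic_volume cE.
  rewrite ltr_pXn2r ?nnegrE ?mulr_ge0 ?powR_ge0 ?bigmax_ge_id ?(ltW c0)//.
  by rewrite ltr_pM2l.
apply/seteqP; split => x /=; rewrite ?E.
  move=> /bigmax_ltP[_ xc] i; rewrite tnth_mktuple -/c cE.
  by have := xc i isT; rewrite ltr_norml => /andP[? ?]; apply/andP; split; lra.
move=> xc; apply/bigmax_ltP; split => // i _.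
have := xc i; rewrite tnth_mktuple -/c cE ltr_norml => /andP[? ?].
by apply/andP; split; lra.
Qed.

Lemma cubic_volume_lt_set0 s : (s <= 0)%R ->
  [set x | (cubic_volume x < s)%R] = set0.
Proof.
move=> s0; rewrite -subset0 => x /= /lt_le_trans /(_ s0).
by rewrite ltNge cubic_volume_ge0.
Qed.

Lemma lebesgue_cubic_volume_lt (y : \bar R) : 0 <= y ->
  lebesgue_euclid [set x : n.-tuple R | (cubic_volume x)%:E < y] = y.
Proof.
case: y => [y| |]//.
  rewrite lee_fin le_eqVlt => /predU1P[<-|y0].
    rewrite (_ : [set _ | _] = [set x | (cubic_volume x < 0)%R])//.
    by rewrite cubic_volume_lt_set0// measure0.
  rewrite (_ : [set _ | _] = [set x | (cubic_volume x < y)%R])//.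
  by rewrite cubic_volume_lt// lebesgue_centred_cube.
move=> _; apply/eqyP => s s0; rewrite -(lebesgue_centred_cube s s0).
by apply: le_mu_ext => x _ /=; rewrite ltry.
Qed.

Lemma measurable_cubic_volume_lt (y : \bar R) :
  measurable ([set x : n.-tuple R | (cubic_volume x)%:E < y] : set (euclid R n)).
Proof.
case: y => [y| |].
- rewrite (_ : [set _ | _] = [set x | (cubic_volume x < y)%R])//.
  have [y0|y0] := leP y 0%R; first by rewrite cubic_volume_lt_set0.
  by rewrite cubic_volume_lt//; exact: measurable_open_cube.
- by rewrite (_ : [set _ | _] = setT)//; apply/seteqP; split => x //= _; rewrite ltry.
- by rewrite (_ : [set _ | _] = set0)// -subset0 => x.
Qed.

(** [h^*] transplanted to the space so that its superlevel sets are centred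
    cubes: a function equimeasurable with [h] for which those cubes are optimal
    in the maximal function. *)
Definition cubic_rearrangement (h : n.-tuple R -> \bar R) (x : n.-tuple R) :=
  rearrangement h (cubic_volume x).

Lemma superlevel_cubic_rearrangement h (l : R) : lebesgue_measurable h ->
  (0 <= l)%R -> [set x | l%:E < `|cubic_rearrangement h x|] =
  [set x | (cubic_volume x)%:E < lebesgue_euclid [set x | l%:E < `|h x|]].
Proof.
move=> mh l0; apply/seteqP; split => x /=;
  by rewrite gee0_abs ?rearrangement_ge0// lt_rearrangement.
Qed.

Lemma measurable_cubic_rearrangement h : lebesgue_measurable h ->
  lebesgue_measurable (cubic_rearrangement h).
Proof.
move=> mh; apply: (measurability _ (ErealGenOInfty.measurableE R)).
move=> _ [_ [l ->] <-]; rewrite setTI.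
have [l0|l0] := leP 0%R l.
  rewrite (_ : _ @^-1` _ = [set x | l%:E < `|cubic_rearrangement h x|]).
    by rewrite superlevel_cubic_rearrangement//; exact: measurable_cubic_volume_lt.
  apply/seteqP; split => x /=; rewrite in_itv/= andbT gee0_abs//;
    exact: rearrangement_ge0.
rewrite (_ : _ @^-1` _ = setT)//; apply/seteqP; split => x //= _.
rewrite in_itv/= andbT; apply: (@lt_le_trans _ _ 0); first by rewrite lte_fin.
exact: rearrangement_ge0.
Qed.

Lemma rearrangement_cubic_rearrangement h : lebesgue_measurable h ->
  rearrangement (cubic_rearrangement h) = rearrangement h.
Proof.
move=> mh; apply/funext => t.
apply: eq_of_real_lt; rewrite ?rearrangement_ge0// => l l0.
rewrite !lt_rearrangement//; last exact: measurable_cubic_rearrangement.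
by rewrite superlevel_cubic_rearrangement// lebesgue_cubic_volume_lt.
Qed.

(** The superlevel sets of the transplant are centred cubes, nested with the one
    of volume [tau], so the restriction only truncates their measures at [tau]. *)
Lemma rearrangement_restr_centred_cube h (s tau : R) : lebesgue_measurable h ->
  (0 < tau)%R -> (s < tau)%R ->
  rearrangement h s <=
  rearrangement (fun x => cubic_rearrangement h x * (\1_(centred_cube tau) x)%:E) s.
Proof.
move=> mh tau0 stau; apply: le_of_real_lt; first exact: rearrangement_ge0.
move=> l l0; rewrite lt_rearrangement// => sl; apply/ltW.
have mc := measurable_cubic_rearrangement _ mh.
have mQ : measurable (centred_cube tau) by exact: measurable_open_cube.
rewrite lt_rearrangement//; last exact: measurable_restr.
rewrite superlevel_restr// superlevel_cubic_rearrangement//.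
rewrite -cubic_volume_lt//.
rewrite (_ : _ `&` _ = [set x | (cubic_volume x)%:E <
    Order.min (lebesgue_euclid [set x | l%:E < `|h x|]) tau%:E]).
  rewrite lebesgue_cubic_volume_lt; first by rewrite lt_min sl lte_fin.
  by rewrite le_min lee_fin (ltW tau0) andbT.
by apply/seteqP; split => x /=; rewrite lt_min lte_fin => /andP.
Qed.

(** For the power [1/alpha] of [h^*] transplanted to the space, every [x] in the
    centred cube of volume [tau] sees that cube in the supremum that defines the
    maximal function; hence the latter exceeds [profile(tau)^(1/alpha)] on a set
    of measure [tau]. *)
Lemma rearrangement_maximal_ge (alpha : R) (phi b : R -> R) h :
  (0 < alpha)%R -> (forall t, (0 < t)%R -> (0 < phi t)%R) -> weight b ->
  lebesgue_measurable h -> forall t tau, (0 < t)%R -> (t < tau)%R ->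
  profile alpha phi b h tau `^ alpha^-1 <= rearrangement (maximal_fun phi alpha b
      (fun x => `|cubic_rearrangement h x| `^ alpha^-1)) t.
Proof.
move=> a0 phi0 wb mh t tau t0 ttau; have tau0 := lt_trans t0 ttau.
have mc := measurable_cubic_rearrangement _ mh.
set f := fun x => _ `^ _.
have mf : lebesgue_measurable f by exact: measurable_abse_powR.
apply: le_ereal_inf_tmp => _ [l [l0 lt] <-]; rewrite leNgt; apply/negP => lG.
move: lt; rewrite leNgt => /negP; apply.
apply: (@lt_le_trans _ _ tau%:E); first by rewrite lte_fin.
rewrite -(lebesgue_centred_cube tau)//; apply: le_mu_ext => x xQ /=.
rewrite gee0_abs; last exact: maximal_fun_ge0.
apply: (lt_le_trans lG); apply: le_ereal_sup_tmp.
have mQ : measurable (centred_cube tau) by exact: measurable_open_cube.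
exists (lorentz_norm alpha b (fun y => f y * (\1_(centred_cube tau) y)%:E) *
  ((phi (fine (lebesgue_euclid (centred_cube tau))))^-1)%:E).
  exists (centred_cube tau) => //; split => //.
  by do 2 eexists; split; [|reflexivity]; rewrite powR_gt0.
rewrite lebesgue_centred_cube// lorentz_norm_powE//.
have fE : (fun y => `|f y| `^ alpha * (\1_(centred_cube tau) y)%:E) =
    (fun y => cubic_rearrangement h y * (\1_(centred_cube tau) y)%:E).
  apply/funext => y; congr (_ * _).
  rewrite /f (gee0_abs (poweR_ge0 _ _)) -poweRrM mulVf ?gt_eqF//.
  by rewrite poweRe1 ?abse_ge0// gee0_abs// rearrangement_ge0.
have phiE : ((phi tau `^ alpha)^-1)%:E `^ alpha^-1 = ((phi tau)^-1)%:E.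
  rewrite poweR_EFin -powR_inv1 ?powR_ge0// -!powRrM mulN1r mulrN mulfV ?gt_eqF//.
  by rewrite powR_inv1// ltW// phi0.
rewrite fE /profile muleC poweRM; last 2 first.
- exact: integral_rearrangement_ge0.
- by rewrite lee_fin invr_ge0 powR_ge0.
rewrite phiE.
apply: lee_wpmul2r; first by rewrite lee_fin invr_ge0 ltW// phi0.
apply: le_poweR; first by rewrite invr_ge0 ltW.
  exact: integral_rearrangement_ge0.
set r := fun y => cubic_rearrangement h y * _.
apply: (@le_trans _ _ (\int[@completed_lebesgue_measure R]_(s in `]0%R, tau[)
  (rearrangement r s * (b s)%:E))).
  have mrb (g : n.-tuple R -> \bar R) :
    measurable_fun (`]0%R, tau[ : set (eline R)) (fun s => rearrangement g s * (b s)%:E).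
    apply: (@measurable_funS _ _ (eline R) _ `]0%R, +oo[).
    - exact: measurable_itv_eline.
    - by move=> s; rewrite /= !in_itv/= => /andP[->].
    exact: measurable_rearrangement_weight.
  have [_ b0 _] := wb; apply: ge0_le_integral.
  - exact: measurable_itv_eline.
  - move=> s; rewrite /= in_itv/= => /andP[s0 _].
    exact: rearrangement_weight_ge0.
  - exact: mrb.
  - exact: mrb.
  - move=> s; rewrite /= in_itv/= => /andP[s0 stau].
    apply: lee_wpmul2r; first by rewrite lee_fin b0.
    exact: rearrangement_restr_centred_cube.
apply: ge0_subset_integral.
- exact: measurable_itv_eline.
- exact: measurable_itv_eline.
- exact: measurable_rearrangement_weight.
- move=> s; rewrite /= in_itv/= andbT => s0.
  exact: rearrangement_weight_ge0.
- by move=> s; rewrite /= !in_itv/= => /andP[->].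
Qed.

End cubic_volume.

(** * The equivalence *)


(** The previous bound covers [tau > t] only. Doubling [tau] costs a constant
    factor and makes every [tau >= t] admissible. *)
Lemma sup_operator_le_rearrangement_maximal {R : realType} (n : nat)
    (alpha r : R) (phi b : R -> R) : (0 < n)%N ->
  (0 < alpha)%R -> (0 < r)%R ->
  (forall t, (0 < t)%R -> (0 < phi t)%R) -> Qclass r phi -> weight b ->
  (forall t, (0 < t)%R -> 0 < primitive b t < +oo) ->
  exists2 C : R, (0 < C)%R &
    forall h : n.-tuple R -> \bar R, lebesgue_measurable h ->
    forall t, (0 < t)%R ->
      (sup_operator (fun t => fine (primitive b t) / phi t `^ alpha)%R b
        (rearrangement h) t) `^ alpha^-1 <=
      C%:E * rearrangement (maximal_fun phi alpha b
        (fun x => `|cubic_rearrangement h x| `^ alpha^-1)) t.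
Proof.
move=> n0 a0 r0 phi0 Qphi wb Bfin.
have [C C0 HC] := Qclass_dilation _ _ 1 r0 phi0 Qphi.
exists C => // h mh t t0; set Mf := rearrangement _ _.
have Mf0 : 0 <= Mf by exact: rearrangement_ge0.
have C0' : 0 <= C%:E by rewrite lee_fin ltW.
have -> : C%:E * Mf = ((C%:E * Mf) `^ alpha) `^ alpha^-1.
  by rewrite -poweRrM mulfV ?gt_eqF// poweRe1// mule_ge0.
apply: le_poweR; [by rewrite invr_ge0 ltW|exact: sup_operator_ge0|].
apply: sup_operator_le => // tau ttau; have tau0 := lt_le_trans t0 ttau.
apply: (le_trans (profile_dilation _ _ _ _ wb phi0 1 C (ltW a0) C0 HC _ tau0)).
rewrite poweRM// poweR_EFin lee_wpmul2l ?lee_fin ?powR_ge0//.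
have t2 : (t < 2%:R * tau)%R by lra.
have := rearrangement_maximal_ge n0 alpha phi b h a0 phi0 wb mh t (2%:R * tau)%R t0 t2.
move=> /(le_poweR alpha _ _ (ltW a0) (poweR_ge0 _ _)).
by rewrite -poweRrM mulVf ?gt_eqF// poweRe1// profile_ge0.
Qed.

Lemma le_weighted_norm {R : realType} (q c : R) (w : R -> R)
    (X Y : R -> \bar R) : (0 < q)%R -> (0 < c)%R -> weight w ->
  (forall x, (0 < x)%R -> 0 <= X x) -> (forall x, (0 < x)%R -> 0 <= Y x) ->
  (forall s t, (0 < s)%R -> (s <= t)%R -> X t <= X s) ->
  (forall s t, (0 < s)%R -> (s <= t)%R -> Y t <= Y s) ->
  (forall x, (0 < x)%R -> X x <= c%:E * Y x) ->
  (\int[@completed_lebesgue_measure R]_(x in `]0%R, +oo[)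
      (X x `^ q * (w x)%:E)) `^ q^-1 <=
  c%:E * (\int[@completed_lebesgue_measure R]_(x in `]0%R, +oo[)
      (Y x `^ q * (w x)%:E)) `^ q^-1.
Proof.
move=> q0 c0 [mw w0 _] X0 Y0 Xn Yn XY.
have mpow (Z : R -> \bar R) :
    (forall s t, (0 < s)%R -> (s <= t)%R -> Z t <= Z s) ->
    measurable_fun (`]0%R, +oo[ : set (eline R)) (fun x => Z x `^ q * (w x)%:E).
  move=> Zn; apply: emeasurable_funM; last exact/measurable_EFinP.
  apply: (measurableT_comp (measurable_poweR q)).
  exact: measurable_fun_nincr.
have mD := @measurable_itv_eline R `]0%R, +oo[.
have pos (Z : R -> \bar R) x : x \in `]0%R, +oo[%classic -> 0 <= Z x `^ q * (w x)%:E.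
  rewrite inE/= in_itv/= andbT => x0.
  by rewrite mule_ge0 ?poweR_ge0// lee_fin w0.
have Ypos : 0 <= \int[@completed_lebesgue_measure R]_(x in `]0%R, +oo[)
    (Y x `^ q * (w x)%:E).
  by apply: integral_ge0 => x Dx; apply: pos; rewrite inE.
have -> : c%:E = ((c `^ q)%:E) `^ q^-1.
  by rewrite poweR_EFin -powRrM mulfV ?gt_eqF// powRr1// ltW.
rewrite -poweRM ?lee_fin ?powR_ge0//.
apply: le_poweR.
- by rewrite invr_ge0 ltW.
- by apply: integral_ge0 => x Dx; apply: pos; rewrite inE.
rewrite -ge0_integralZl; last 4 first.
- exact: mD.
- exact: mpow.
- by move=> x Dx; apply: pos; rewrite inE.
- by rewrite lee_fin powR_ge0.
apply: ge0_le_integral.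
- exact: mD.
- by move=> x Dx; apply: pos; rewrite inE.
- exact: mpow.
- by apply: emeasurable_funM; [exact: measurable_cst|exact: mpow].
- move=> x; rewrite /= in_itv/= andbT => x0; rewrite muleA.
  apply: lee_wpmul2r; first by rewrite lee_fin w0.
  rewrite -poweR_EFin -poweRM ?Y0 ?lee_fin ?(ltW c0)//.
  by apply: le_poweR; [exact: ltW|exact: X0|exact: XY].
Qed.

Theorem theorem4p1 (R : realType) (n : nat) (p m q alpha r : R)
    (v w phi b : R -> R) :
  let mu := @completed_lebesgue_measure R in
  let B := fun t : R => fine (primitive b t) in
  (0 < n)%N ->
  (0 < p)%R -> (0 < m)%R -> (0 < q)%R -> (0 < alpha)%R -> (alpha <= r)%R ->
  weight v -> weight w ->
  (forall t, (0 < t)%R -> (0 < phi t)%R) ->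
  quasi_increasing phi -> Qclass r phi ->
  weight b ->
  (forall t, (0 < t)%R -> 0 < primitive b t < +oo) ->
  delta2 B ->
  B t @[t --> +oo%R] --> +oo%R ->
  quasi_increasing (fun t => B t / t `^ (alpha / r))%R ->
  (exists2 C : R, (0 < C)%R &
    forall f : n.-tuple R -> \bar R, lebesgue_measurable f ->
      (\int[mu]_(x in `]0%R, +oo[)
         (rearrangement (maximal_fun phi alpha b f) x `^ q * (w x)%:E)) `^ q^-1
      <= C%:E *
      (\int[mu]_(x in `]0%R, +oo[)
         ((\int[mu]_(tau in `]0%R, x[) (rearrangement f tau `^ p)) `^ (m / p)
            * (v x)%:E)) `^ m^-1)
  <->
  (exists2 C : R, (0 < C)%R &
    forall h : n.-tuple R -> \bar R, lebesgue_measurable h ->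
      (\int[mu]_(x in `]0%R, +oo[)
         (sup_operator (fun t => B t / phi t `^ alpha)%R b (rearrangement h) x
            `^ (q / alpha) * (w x)%:E)) `^ q^-1
      <= C%:E *
      (\int[mu]_(x in `]0%R, +oo[)
         ((\int[mu]_(tau in `]0%R, x[)
             (rearrangement h tau `^ (p / alpha))) `^ (m / p)
            * (v x)%:E)) `^ m^-1).
Proof.
move=> mu B n0 p0 m0 q0 a0 ar _ ww phi0 _ Qphi wb Bfin _ _ qi.
have r0 : (0 < r)%R by exact: lt_le_trans ar.
pose S (h : n.-tuple R -> \bar R) :=
  sup_operator (fun t => B t / phi t `^ alpha)%R b (rearrangement h).
have S0 h t : (0 < t)%R -> 0 <= S h t by move=> t0; exact: sup_operator_ge0.
have Sn h s t : (0 < s)%R -> (s <= t)%R -> S h t <= S h s.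
  by move=> s0 st; exact: sup_operator_nincr.
have Sroot_n h s t : (0 < s)%R -> (s <= t)%R ->
    S h t `^ alpha^-1 <= S h s `^ alpha^-1.
  move=> s0 st; apply: le_poweR; [by rewrite invr_ge0 ltW| |exact: Sn].
  by apply: S0; exact: lt_le_trans st.
have SqE h x : S h x `^ (q / alpha) = (S h x `^ alpha^-1) `^ q.
  by rewrite -poweRrM mulrC.
have Mn (f : n.-tuple R -> \bar R) s t : (0 < s)%R -> (s <= t)%R ->
    rearrangement f t <= rearrangement f s.
  by move=> _; exact: rearrangement_nincr.
split=> [[C C0 HC]|[C C0 HC]].
- have [c c0 Hc] := sup_operator_le_rearrangement_maximal n alpha r phi b
    n0 a0 r0 phi0 Qphi wb Bfin.
  exists (c * C)%R; first exact: mulr_gt0.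
  move=> h mh; have mk := measurable_cubic_rearrangement n0 _ mh.
  pose f x := `|cubic_rearrangement h x| `^ alpha^-1.
  have mf : lebesgue_measurable f by exact: measurable_abse_powR.
  have fE t : rearrangement f t = rearrangement h t `^ alpha^-1.
    by rewrite rearrangement_poweR ?invr_gt0// rearrangement_cubic_rearrangement.
  have rhsE x : \int[mu]_(tau in `]0%R, x[) (rearrangement f tau `^ p) =
      \int[mu]_(tau in `]0%R, x[) (rearrangement h tau `^ (p / alpha)).
    by apply: eq_integral => t _; rewrite fE -poweRrM mulrC.
  have := HC f mf; under [in leRHS]eq_integral do rewrite rhsE.
  move=> /(lee_wpmul2l (ltW c0 : 0 <= c%:E)).
  rewrite muleA -EFinM; apply: le_trans.
  under eq_integral do rewrite SqE.
  apply: le_weighted_norm => //.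
  + by move=> x _; exact: poweR_ge0.
  + by move=> x _; exact: rearrangement_ge0.
  + exact: Sroot_n.
  + exact: Mn.
  + by move=> x; exact: Hc.
- have [c c0 Hc] := rearrangement_maximal_le n alpha r phi b a0 ar phi0 Qphi wb Bfin qi.
  exists (c * C)%R; first exact: mulr_gt0.
  move=> f mf; pose h x := `|f x| `^ alpha.
  have mh : lebesgue_measurable h by exact: measurable_abse_powR.
  have rhsE x : \int[mu]_(tau in `]0%R, x[) (rearrangement h tau `^ (p / alpha)) =
      \int[mu]_(tau in `]0%R, x[) (rearrangement f tau `^ p).
    apply: eq_integral => t _.
    by rewrite rearrangement_poweR// -poweRrM mulrC divfK// gt_eqF.
  have := HC h mh; under [in leRHS]eq_integral do rewrite rhsE.
  move=> /(lee_wpmul2l (ltW c0 : 0 <= c%:E)).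
  rewrite muleA -EFinM; apply: le_trans.
  under [in leRHS]eq_integral do rewrite SqE.
  apply: le_weighted_norm => //.
  + by move=> x _; exact: rearrangement_ge0.
  + by move=> x _; exact: poweR_ge0.
  + exact: Mn.
  + exact: Sroot_n.
  + by move=> x; exact: Hc.
Qed.
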